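(* Let $q$ be a power of a prime $p$, $K$ the algebraic closure of $\mathbb{F}_q$, and let $m\geq 2$, $r\geq 2$ be integers with $p\nmid m$. Let $\mathcal{X}$ be the algebraic curve over $K$ defined by the affine equation $$y^m=\prod_{i=1}^r (x-\alpha_i)^{\lambda_i},\qquad \lambda_i\in\mathbb{N},\quad 1\leq\lambda_i<m,$$ where $\alpha_1,\dots,\alpha_r$ are pairwise distinct elements of $K$. Put $\lambda_0:=\sum_{i=1}^r\lambda_i$ and suppose $\gcd(m,\lambda_0)=1$. For $k\in\{r,\dots,\lambda_0-1\}$ let $$\eta_k:=\max\left\{\min_{1\leq i\leq r}\left\lfloor\frac{s_im}{\lambda_i}\right\rfloor : s_1,\dots,s_r\in\mathbb{N},\ \sum_{i=1}^r s_i=k,\ 1\leq s_i\leq\lambda_i\right\}$$ and $B_k:=\{mk-k'\lambda_0 : k'=1,\dots,\eta_k\}$. Then the Weierstrass semigroup at the only place at infinity $Q_\infty$ of $K(\mathcal{X})$ is given by $$H(Q_\infty)=\langle m,\lambda_0\rangle\cup\bigcup_{k=r}^{\lambda_0-1}B_k,$$ where the union is disjoint (the sets $\langle m,\lambda_0\rangle, B_r,\dots,B_{\lambda_0-1}$ are pairwise disjoint). In particular, $$H(Q_\infty)=\langle m,\ \lambda_0,\ mk-\lambda_0\eta_k : k=r,\dots,\lambda_0-1\rangle.$$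
   Context: $\mathcal{X}$ denotes the nonsingular projective irreducible curve over $K$ with function field $K(\mathcal{X})=K(x,y)$; $Q_\infty$ is the unique place of $K(\mathcal{X})$ lying over the pole of $x$ in $K(x)$. For a place $Q$, $H(Q):=\{s\in\mathbb{N}_0 : (z)_\infty=sQ \text{ for some } z\in K(\mathcal{X})\}$, where $(z)_\infty$ is the pole divisor of $z$. The notation $\langle a_1,\dots,a_d\rangle$ means $\{t_1a_1+\cdots+t_da_d : t_1,\dots,t_d\in\mathbb{N}_0\}$. If $r=\lambda_0$ there are no indices $k$ and the union over $k$ is empty. *)

(* Defs.v *)
From HB Require Import structures.
From mathcomp Require Import all_boot all_order all_algebra all_field.
From mathcomp Require Import boolp classical_sets.

Set Implicit Arguments.
Unset Strict Implicit.
Unset Printing Implicit Defensive.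

Import Order.TTheory GRing.Theory Num.Theory.
Local Open Scope classical_set_scope.
Local Open Scope ring_scope.

Definition is_algebraic_closure (k : fieldType) (K : closedFieldType)
    (j : {rmorphism k -> K}) : Prop :=
  forall z : K, algebraicOver j z.

Section Places.
Variables (K F : fieldType) (c : {rmorphism K -> F}).

Record is_valuation_ring (O : set F) : Prop := {
  vring_const : forall a, O (c a);
  vring_sub : forall z w, O z -> O w -> O (z - w);
  vring_mul : forall z w, O z -> O w -> O (z * w);
  vring_neq_const : exists2 z, O z & forall a, z <> c a;
  vring_neq_full : exists z, ~ O z;
  vring_total : forall z, O z \/ O z^-1
}.

(* A place is the maximal ideal of a valuation ring of F/K; ideal and ring
   determine each other, and the ring is the component stored here. *)
Record place := Place {
  vring : set F;
  vringP : is_valuation_ring vring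
}.

Definition place_unit (P : place) : set F :=
  [set z | [/\ z != 0, vring P z & vring P z^-1]].

Definition place_ideal (P : place) : set F :=
  [set z | vring P z /\ ~ place_unit P z].

Definition uniformizer (P : place) (t : F) : Prop :=
  place_ideal P = [set z | exists2 w, vring P w & z = t * w].

(* The integer n with z = t ^ n * u.  It exists and is unique when z != 0 and
   F/K is a function field in one variable; the value at z = 0 is junk. *)
Definition valuation (P : place) (z : F) : int :=
  xget 0 [set n : int | exists t u,
    [/\ uniformizer P t, place_unit P u & z = t ^ n * u]].

(* Divisors are represented by their coefficient functions; finiteness of the
   support is not imposed. *)
Definition divisor := place -> int.

Definition pole_divisor (z : F) : divisor :=
  fun P => Num.max 0 (- valuation P z).

Definition multiple_of_place (s : nat) (Q : place) : divisor :=
  fun P => if `[< P = Q >] then s%:Z else 0.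

Definition weierstrass_semigroup (Q : place) : set nat :=
  [set s | exists2 z : F, z != 0 & pole_divisor z = multiple_of_place s Q].

End Places.

Definition lies_over (K E F : fieldType) (c : {rmorphism K -> E})
    (d : {rmorphism K -> F}) (h : {rmorphism E -> F})
    (Q : place d) (P : place c) : Prop :=
  forall z : E, place_ideal P z -> place_ideal Q (h z).

Section FunctionField.
Variable K : fieldType.

Definition ratfun := {fraction {poly K}}.

Definition ratfun_const : {rmorphism K -> ratfun} :=
  (@tofrac {poly K}) \o (@polyC K).

Definition ratfun_x : ratfun := tofrac ('X : {poly K}).

Variable L : fieldExtType ratfun.

Definition ext_const : {rmorphism K -> L} := in_alg L \o ratfun_const.

Definition ext_x : L := ratfun_x%:A.

End FunctionField.

Section Numerical.
Local Open Scope nat_scope.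

Definition generated_semigroup (a : seq nat) : set nat :=
  [set n | exists t : 'I_(size a) -> nat,
     n = \sum_(i < size a) t i * nth 0 a i].

Variables (m r : nat) (lambda : 'I_r -> nat).

Definition lambda_sum : nat := \sum_(i < r) lambda i.

Definition admissible (k : nat) (s : {ffun 'I_r -> 'I_k.+1}) : bool :=
  (\sum_(i < r) s i == k) && [forall i, 1 <= s i <= lambda i].

(* Bounding each s_i by k loses nothing as they sum to k.  The unit m given to
   minn does not affect the minimum, since s_i <= lambda_i makes every term at
   most m. *)
Definition eta_val (k : nat) : nat :=
  \max_(s : {ffun 'I_r -> 'I_k.+1} | admissible s)
    \big[minn/m]_(i < r) (s i * m %/ lambda i).

Lemma bigmin_leq (k : nat) (s : {ffun 'I_r -> 'I_k.+1}) (i : 'I_r) :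
  \big[minn/m]_(i < r) (s i * m %/ lambda i) <= s i * m %/ lambda i.
Proof.
have: i \in index_enum 'I_r by rewrite mem_index_enum.
elim: (index_enum _) => // j e IHe; rewrite in_cons big_cons.
case/predU1P=> [<-|/IHe le_e]; first exact: geq_minl.
exact: leq_trans (geq_minr _ _) le_e.
Qed.

(* So m * k - k' * lambda_sum with k' <= eta_val k is never truncated. *)
Lemma eta_lambda_leq (k : nat) : lambda_sum * eta_val k <= m * k.
Proof.
rewrite /eta_val; elim/big_rec: _ => [|s e /andP[/eqP sum_s _] IHe].
  by rewrite muln0.
rewrite maxnMr geq_max IHe andbT mulnC -[X in m * X]sum_s.
rewrite big_distrr /lambda_sum big_distrr /=; apply: leq_sum => i _.
rewrite [m * _]mulnC (leq_trans _ (leq_divM (s i * m) (lambda i))) //.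
by rewrite leq_mul2r bigmin_leq orbT.
Qed.

Definition B_set (k : nat) : set nat :=
  [set m * k - k' * lambda_sum | k' in [set k' | 1 <= k' <= eta_val k]].

End Numerical.

(* Main.v *)
(** Put l0 = lambda_0.  At Q = Q_infinity the functions x and y have orders -m
    and -l0, and gcd(m, l0) = 1 makes the terms of z = sum_(j < m) g_j(x) y^j
    have pairwise distinct orders, so v_Q(z) = - max_j (m deg g_j + l0 j); this
    also shows that Q is the only place above infinity.  If z is regular away
    from Q then so is each term g_j(x) y^j, because it is an average of the
    conjugates of z under y -> zeta y (zeta^m = 1).  Taking m-th powers and
    looking above each point of the affine line, g_j(x) y^j is regular away
    from Q iff g_j prod_i (x - alpha_i)^floor(j lambda_i / m) is a polynomial.
    Hence H(Q) = { m a + l0 j - m sum_i floor(j lambda_i / m) }.  For j > 0,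
    writing k' = m - j turns such an element into m k - k' l0 with
    k - a = sum_i ceil(k' lambda_i / m), and k' <= eta_k says exactly that
    k >= sum_i ceil(k' lambda_i / m) as long as k <= l0. *)

Require Import Defs.
From HB Require Import structures.
From mathcomp Require Import all_boot all_order all_algebra all_field.
From mathcomp Require Import ring zify.
From mathcomp Require Import boolp classical_sets.

Set Implicit Arguments.
Unset Strict Implicit.
Unset Printing Implicit Defensive.

Import Order.TTheory GRing.Theory Num.Theory.
Local Open Scope classical_set_scope.
Local Open Scope ring_scope.

(** * Valuation rings of a function field *)

Section PlaceTheory.
Variables (K F : fieldType) (c : {rmorphism K -> F}) (P : place c).
Implicit Types (z w u t : F).

Lemma vring_cst a : vring P (c a).
Proof. exact: vring_const (vringP P) a. Qed.

Lemma vring0 : vring P 0.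
Proof. by rewrite -(rmorph0 c); apply: vring_cst. Qed.

Lemma vring1 : vring P 1.
Proof. by rewrite -(rmorph1 c); apply: vring_cst. Qed.

Lemma vringB z w : vring P z -> vring P w -> vring P (z - w).
Proof. exact: vring_sub (vringP P) z w. Qed.

Lemma vringM z w : vring P z -> vring P w -> vring P (z * w).
Proof. exact: vring_mul (vringP P) z w. Qed.

Lemma vringN z : vring P z -> vring P (- z).
Proof. by move=> Oz; rewrite -sub0r; apply: vringB => //; apply: vring0. Qed.

Lemma vringD z w : vring P z -> vring P w -> vring P (z + w).
Proof. by move=> Oz /vringN Ow; rewrite -[w]opprK; apply: vringB. Qed.

Lemma vringX z n : vring P z -> vring P (z ^+ n).
Proof.
move=> Oz; elim: n => [|n IHn]; first exact: vring1.
by rewrite exprS; apply: vringM.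
Qed.

Lemma vring_sum (I : Type) (s : seq I) (Q : pred I) (w : I -> F) :
  (forall i, Q i -> vring P (w i)) -> vring P (\sum_(i <- s | Q i) w i).
Proof. by move=> Ow; elim/big_ind: _ => //; [exact: vring0|exact: vringD]. Qed.

Lemma vring_prod (I : Type) (s : seq I) (Q : pred I) (w : I -> F) :
  (forall i, Q i -> vring P (w i)) -> vring P (\prod_(i <- s | Q i) w i).
Proof. by move=> Ow; elim/big_ind: _ => //; [exact: vring1|exact: vringM]. Qed.

Lemma vring_or_inv z : vring P z \/ vring P z^-1.
Proof. exact: vring_total (vringP P) z. Qed.

Lemma punit1 : place_unit P 1.
Proof. by split; rewrite ?oner_neq0 ?invr1 //; apply: vring1. Qed.

Lemma punitM z w : place_unit P z -> place_unit P w -> place_unit P (z * w).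
Proof.
case=> nz Oz Ozi [nw Ow Owi]; split; first by rewrite mulf_neq0.
  exact: vringM.
by rewrite invfM; apply: vringM.
Qed.

Lemma punitV z : place_unit P z -> place_unit P z^-1.
Proof. by case=> nz Oz Ozi; split; rewrite ?invr_eq0 ?invrK. Qed.

Lemma punitX z n : place_unit P z -> place_unit P (z ^+ n).
Proof.
move=> Uz; elim: n => [|n IHn]; first exact: punit1.
by rewrite exprS; apply: punitM.
Qed.

Lemma punitXz z (n : int) : place_unit P z -> place_unit P (z ^ n).
Proof.
move=> Uz; case: n => n; first exact: punitX.
by rewrite NegzE -exprnN; apply/punitV/punitX.
Qed.

Lemma punit_cst a : a != 0 -> place_unit P (c a).
Proof.
move=> nza; split; rewrite ?fmorph_eq0 -?fmorphV //; exact: vring_cst.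
Qed.

Lemma punit_vring z : place_unit P z -> vring P z. Proof. by case. Qed.
Lemma punit_neq0 z : place_unit P z -> z != 0. Proof. by case. Qed.
Lemma pideal_vring z : place_ideal P z -> vring P z. Proof. by case. Qed.

Lemma vring_case z : vring P z -> place_unit P z \/ place_ideal P z.
Proof. by move=> Oz; have [|nU] := pselect (place_unit P z); [left|right]. Qed.

Lemma pideal0 : place_ideal P 0.
Proof. by split; [exact: vring0|case; rewrite eqxx]. Qed.

Lemma pideal_inv z : z != 0 -> place_ideal P z -> ~ vring P z^-1.
Proof. by move=> nz [Oz nU] Ozi; apply: nU. Qed.

Lemma nvring_pideal z : ~ vring P z -> place_ideal P z^-1.
Proof.
move=> nOz; split; first by case: (vring_or_inv z).
by case=> _ _; rewrite invrK.
Qed.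

Lemma pidealM z w : place_ideal P z -> vring P w -> place_ideal P (z * w).
Proof.
move=> [Oz nU] Ow; split; first exact: vringM.
case; rewrite mulf_eq0 negb_or => /andP[nz nw] _ Oi; apply: nU; split=> //.
have -> : z^-1 = w * (z * w)^-1 by rewrite invfM mulrCA divff // mulr1.
exact: vringM.
Qed.

(** Either z / w or w / z lies in the ring, so the sum is a ring element times whichever of z, w
    divides the other. *)
Lemma pidealD z w : place_ideal P z -> place_ideal P w -> place_ideal P (z + w).
Proof.
have [-> _|nz Mz] := eqVneq z 0; first by rewrite add0r.
have [->|nw Mw] := eqVneq w 0; first by rewrite addr0.
case: (vring_or_inv (z / w)) => Ozw.
  have ->: z + w = w * (z / w + 1) by rewrite mulrDr mulr1 mulrC divfK.
  by apply: pidealM => //; apply: vringD => //; apply: vring1.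
have ->: z + w = z * (1 + (z / w)^-1).
  by rewrite mulrDr mulr1 invf_div mulrC divfK // divfK.
by apply: pidealM => //; apply: vringD => //; apply: vring1.
Qed.

Lemma pideal_sum (I : Type) (s : seq I) (Q : pred I) (w : I -> F) :
  (forall i, Q i -> place_ideal P (w i)) ->
  place_ideal P (\sum_(i <- s | Q i) w i).
Proof. by move=> Mw; elim/big_ind: _ => //; [exact: pideal0|exact: pidealD]. Qed.

Lemma punitD_pideal u z : place_unit P u -> place_ideal P z -> place_unit P (u + z).
Proof.
move=> Uu Mz; case: (vring_case (vringD (punit_vring Uu) (pideal_vring Mz))) => //.
move=> Muz; have: place_ideal P u.
  rewrite -[u](addrK z); apply: pidealD => //; rewrite -mulrN1.
  by apply: pidealM => //; apply: vringN; apply: vring1.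
by case.
Qed.

(** A case of integral closedness: if z were outside the ring, its inverse would be inside, and z =
    z^n (z^-1)^(n-1) would be inside too. *)
Lemma vring_root z n : (0 < n)%N -> vring P (z ^+ n) -> vring P z.
Proof.
case: n => // n _ Ozn; have [//|nOz] := pselect (vring P z).
have nz: z != 0 by apply/eqP=> z0; apply: nOz; rewrite z0; apply: vring0.
have -> : z = z ^+ n.+1 * z^-1 ^+ n.
  by rewrite exprS exprVn mulfK // expf_neq0.
by apply: vringM => //; apply: vringX; apply: pideal_vring (nvring_pideal nOz).
Qed.

Lemma punit_root z n : (0 < n)%N -> place_unit P (z ^+ n) -> place_unit P z.
Proof.
move=> n_gt0 [nzn Ozn Ozni]; split.
- by move: nzn; rewrite expf_eq0 n_gt0.
- exact: vring_root Ozn.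
- by apply: (vring_root n_gt0); rewrite exprVn.
Qed.

Lemma pidealXz t (n : int) : place_ideal P t -> 0 < n -> place_ideal P (t ^ n).
Proof.
case: n => [[|n]|] //= Mt _; rewrite exprSz.
by apply: pidealM => //; apply: vringX; apply: pideal_vring.
Qed.

Lemma punit_exprz t (n : int) : place_ideal P t -> place_unit P (t ^ n) -> n = 0.
Proof.
move=> Mt; have [-> //|n_neq0 U] := eqVneq n 0.
have [n_gt0|] := ltP 0 n; first by case: (pidealXz Mt n_gt0).
rewrite le_eqVlt (negPf n_neq0) /= -oppr_gt0 => n_lt0.
by case: (pidealXz Mt n_lt0) => _; case; rewrite -invr_expz; apply: punitV.
Qed.

Lemma vring_exprz t (n : int) : t != 0 -> place_ideal P t ->
  vring P (t ^ n) -> 0 <= n.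
Proof.
move=> nt Mt O; rewrite leNgt; apply/negP; rewrite -oppr_gt0 => n_lt0.
case: (pidealXz Mt n_lt0) => On []; split; rewrite ?expfz_neq0 //.
by rewrite -invr_expz invrK.
Qed.

Lemma vringXz t (n : int) : vring P t -> 0 <= n -> vring P (t ^ n).
Proof. by case: n => // n Ot _; apply: vringX. Qed.

Lemma vring_punitM z u : place_unit P u -> vring P (z * u) -> vring P z.
Proof.
move=> Uu Ozu; rewrite -[z](mulfK (punit_neq0 Uu)).
by apply: vringM => //; case: Uu.
Qed.

Lemma uniformizer_pideal t : uniformizer P t -> place_ideal P t.
Proof. by move->; exists 1; [exact: vring1 | rewrite mulr1]. Qed.

Lemma uniformizer_neq0 t : uniformizer P t -> t != 0.
Proof.
move=> Ut; apply/eqP => t0; case: (vring_neq_full (vringP P)) => z nOz.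
have := nvring_pideal nOz; rewrite Ut => -[w _ /eqP].
rewrite t0 mul0r invr_eq0 => /eqP z0; apply: nOz; rewrite z0; exact: vring0.
Qed.

Lemma uniformizer_assoc t t' : uniformizer P t -> uniformizer P t' ->
  place_unit P (t / t').
Proof.
move=> Ut Ut'; have nt := uniformizer_neq0 Ut; have nt' := uniformizer_neq0 Ut'.
have := uniformizer_pideal Ut; rewrite Ut' => -[w Ow tE].
have := uniformizer_pideal Ut'; rewrite Ut => -[w' Ow' tE'].
split; first by rewrite mulf_neq0 ?invr_eq0.
  by rewrite tE mulrC mulKf.
by rewrite invf_div {1}tE' mulrC mulKf.
Qed.

(** Removes the choice made by [xget]: comparing two presentations of z shows that t'^(n' - n) is a
    unit, and a power of an element of the ideal is a unit only for exponent 0. *)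
Lemma valuationE t z u (n : int) :
  uniformizer P t -> place_unit P u -> z = t ^ n * u -> valuation P z = n.
Proof.
move=> Ut Uu zE; rewrite /valuation; case: xgetP => [n' _|]; last first.
  by move=> /(_ n) []; exists t, u.
case=> t' [u' [Ut' Uu' zE']]; apply/eqP; rewrite -subr_eq0; apply/eqP.
apply: (punit_exprz (uniformizer_pideal Ut')).
have nt := uniformizer_neq0 Ut; have nt' := uniformizer_neq0 Ut'.
have -> : t' ^ (n' - n) = (t / t') ^ n * (u / u').
  apply: (mulIf (punit_neq0 Uu')); rewrite -mulrA divfK ?punit_neq0 //.
  rewrite expfzDr // mulrAC -zE' zE expfzMl -!mulrA; congr (_ * _).
  by rewrite mulrC exprz_inv.
apply: punitM; first exact/punitXz/uniformizer_assoc.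
by apply: punitM => //; apply: punitV.
Qed.

Lemma valuation_ge0 z : vring P z -> 0 <= valuation P z.
Proof.
move=> Oz; rewrite /valuation; case: xgetP => // n _ [t [u [Ut Uu zE]]].
apply: (vring_exprz (uniformizer_neq0 Ut) (uniformizer_pideal Ut)).
by apply: (vring_punitM Uu); rewrite -zE.
Qed.

(** A negative value is not the default 0, so it comes from a genuine presentation by a
    uniformizer. *)
Lemma valuation_lt0 z : valuation P z < 0 -> place_ideal P z^-1.
Proof.
rewrite /valuation; case: xgetP => [n _ [t [u [Ut Uu ->]]] n_lt0|]; last first.
  by rewrite ltxx.
rewrite invfM; apply: pidealM; last by case: Uu.
rewrite invr_expz; apply: pidealXz; last by rewrite oppr_gt0.
exact: uniformizer_pideal.
Qed.

Lemma exists_dominant (I : eqType) (w : I -> F) (s : seq I) :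
  has (fun i => w i != 0) s ->
  exists2 i, i \in s & w i != 0 /\ {in s, forall k, vring P (w k / w i)}.
Proof.
elim: s => //= i s IHs; have [wi0 /= /IHs[k ks [wk Ow]]|wi _] := eqVneq (w i) 0.
  exists k; first by rewrite in_cons ks orbT.
  split=> // l; rewrite in_cons => /predU1P[->|/Ow//].
  by rewrite wi0 mul0r; apply: vring0.
have Oii: vring P (w i / w i) by rewrite divff //; apply: vring1.
have [/IHs[k ks [wk Ow]]|/hasPn w0] := boolP (has (fun i => w i != 0) s).
  case: (vring_or_inv (w i / w k)) => Oik.
    exists k; first by rewrite in_cons ks orbT.
    by split=> // l; rewrite in_cons => /predU1P[->|/Ow].
  exists i; first exact: mem_head.
  split=> // l; rewrite in_cons => /predU1P[->//|/Ow Ol].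
  have -> : w l / w i = w l / w k * (w i / w k)^-1 by rewrite invf_div mulrA divfK.
  exact: vringM.
exists i; first exact: mem_head.
split=> // l; rewrite in_cons => /predU1P[->//|/w0].
by rewrite negbK => /eqP->; rewrite mul0r; apply: vring0.
Qed.

(** The equality case of the ultrametric inequality, phrased by divisibility since no valuation is
    available yet: divided by the dominant term, the sum is 1 plus elements of the ideal. *)
Lemma sum_dominant (I : finType) (w : I -> F) :
  (exists i, w i != 0) ->
  (forall i k, i != k -> w i != 0 -> w k != 0 -> ~ place_unit P (w i / w k)) ->
  exists i, [/\ w i != 0, place_unit P ((\sum_k w k) / w i)
              & forall k, vring P (w k / w i)].
Proof.
case=> i0 wi0 nassoc.
have [|i _ [wi Ow]] := @exists_dominant I w (index_enum I).
  by apply/hasP; exists i0; rewrite ?mem_index_enum.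
have {}Ow k : vring P (w k / w i) by apply: Ow; rewrite mem_index_enum.
exists i; split => //; rewrite mulr_suml (bigD1 i) //= divff //.
apply: punitD_pideal; first exact: punit1.
apply: pideal_sum => k ki; have [->|wk] := eqVneq (w k) 0.
  by rewrite mul0r; apply: pideal0.
by split=> //; apply: nassoc.
Qed.

(** * Discreteness from commensurability with a single element *)

Section Discreteness.
Variables (tau : F) (N : nat).
Hypotheses (tau_neq0 : tau != 0) (tau_ideal : place_ideal P tau).
Hypothesis N_gt0 : (0 < N)%N.
Hypothesis commensurable : forall z, z != 0 ->
  exists n : int, place_unit P (z ^+ N / tau ^ n).

(* t is an element whose order (measured by z ^ N ~ tau ^ n) is the least
   positive one. *)
Lemma exists_uniformizer :
  exists2 t, uniformizer P t &
    forall z, z != 0 -> exists (n : int) u, place_unit P u /\ z = t ^ n * u.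
Proof.
(* Read [order z d] as N v(z) = d v(tau). It behaves additively, and its sign decides membership in
   the ring and in the ideal. *)
pose order z (d : int) := z != 0 /\ place_unit P (z ^+ N / tau ^ d).
have orderM z w a b : order z a -> order w b -> order (z * w) (a + b).
  move=> [nz Uz] [nw Uw]; split; first by rewrite mulf_neq0.
  by rewrite exprMn expfzDr // invfM mulrACA; apply: punitM.
have orderV z a : order z a -> order z^-1 (- a).
  move=> [nz Uz]; split; first by rewrite invr_eq0.
  by rewrite -invr_expz exprVn -invfM; apply: punitV.
have orderX z a (k : nat) : order z a -> order (z ^+ k) (a *+ k).
  move=> oz; elim: k => [|k IHk]; last by rewrite exprS mulrS; apply: orderM.
  split; rewrite ?oner_neq0 // expr1n mulr0n expr0z divr1; exact: punit1.
have orderXz z a (k : int) : order z a -> order (z ^ k) (k * a).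
  move=> oz; rewrite mulrC; case: k => k.
    by have := orderX _ _ k oz; rewrite -mulr_natr natz.
  rewrite NegzE mulrN -exprnN; apply: orderV.
  by have := orderX _ _ k.+1 oz; rewrite -mulr_natr natz.
have order_vring z a : order z a -> 0 <= a -> vring P z.
  move=> [nz Uz] a_ge0; apply: (vring_root N_gt0).
  rewrite -[_ ^+ _](@divfK _ (tau ^ a)) ?expfz_neq0 //; apply: vringM.
    exact: punit_vring.
  by apply: vringXz => //; apply: pideal_vring.
have order_ideal z a : order z a -> place_ideal P z -> 0 < a.
  move=> oz [Oz nU]; rewrite ltNge; apply/negP => a_le0; apply: nU; split=> //.
    by case: oz.
  by apply: (order_vring _ (- a)); rewrite ?oppr_ge0 //; apply: orderV.
have: exists d : nat, `[< (0 < d)%N /\ exists z, order z d%:Z >].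
  exists N; apply/asboolP; split=> //; exists tau; split=> //.
  by rewrite divff ?expf_neq0 //; apply: punit1.
move=> /ex_minnP[d /asboolP[d_gt0 [t ot]] d_min].
have {}d_min z (a : int) : order z a -> 0 < a -> d%:Z <= a.
  case: a => // a oz a_gt0; rewrite lez_nat; apply: d_min; apply/asboolP.
  by split => //; exists z.
exists t.
  apply/seteqP; split=> [z Mz|z [w Ow ->]] /=; last first.
    apply: pidealM => //; split; first exact: (order_vring _ d).
    case=> _ _ Oti; have [_ U] := orderV _ _ ot; have := vringX N Oti.
    rewrite -[_ ^+ N](@divfK _ (tau ^ (- d%:Z))) ?expfz_neq0 // mulrC.
    move/(vring_punitM U)/(vring_exprz tau_neq0 tau_ideal).
    by rewrite oppr_ge0 lez_nat leqn0 eqn0Ngt d_gt0.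
  have [->|nz] := eqVneq z 0; first by exists 0; rewrite ?mulr0 //; apply: vring0.
  have [a Ua] := commensurable nz; have oz: order z a by [].
  have a_gt0 := order_ideal _ _ oz Mz.
  exists (z / t); last by rewrite mulrC divfK //; case: ot.
  apply: (order_vring _ (a - d%:Z)); first exact: orderM (orderV _ _ ot).
  by rewrite subr_ge0; apply: d_min oz _.
move=> z nz; have [a Ua] := commensurable nz; have oz: order z a by [].
have nt: t != 0 by case: ot.
(* Euclidean division by the least positive order: the remainder is the order of z / t^k, so
   minimality forces it to be 0 and z / t^k is a unit. *)
pose k := (a %/ d)%Z; exists k, (z / t ^ k); split; last first.
  by rewrite mulrC divfK // expfz_neq0.
have ok: order (z / t ^ k) (a - k * d) by apply/orderM/orderV/orderXz.
have dn0 : d%:Z != 0 by rewrite eqz_nat -lt0n.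
have rE : a - k * d = (a %% d)%Z by rewrite {1}(divz_eq a d) -/k addrC addKr.
have := modz_ge0 a dn0; rewrite -rE le_eqVlt => /predU1P[r0|r_gt0].
  by case: ok => _; rewrite -r0 expr0z divr1; apply: punit_root.
have := d_min _ _ ok r_gt0.
by rewrite rE leNgt ltz_pmod // ltz_nat.
Qed.

(** Converse of [valuation_ge0]. Here a uniformizer must exist, since otherwise the value would be
    the default 0 and say nothing about z. *)
Lemma vring_valuation z : z != 0 -> 0 <= valuation P z -> vring P z.
Proof.
move=> nz; have [t Ut zE] := exists_uniformizer.
have [n [u [Uu {}zE]]] := zE z nz.
rewrite (valuationE Ut Uu zE) zE => n_ge0; apply: vringM (punit_vring Uu).
by apply: vringXz => //; apply: pideal_vring (uniformizer_pideal Ut).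
Qed.

End Discreteness.
End PlaceTheory.

(** * Existence of places *)

Section PlaceExistence.
Variable F : fieldType.
Implicit Types (A B : set F) (z w u tau : F) (p : {poly F}).

Record is_subring A : Prop := {
  subring1 : A 1;
  subringB : forall z w, A z -> A w -> A (z - w);
  subringM : forall z w, A z -> A w -> A (z * w)
}.

Section SubringTheory.
Variables (A : set F) (ringA : is_subring A).

Lemma subring0 : A 0.
Proof. by rewrite -(subrr 1); apply: (subringB ringA); apply: (subring1 ringA). Qed.

Lemma subringD z w : A z -> A w -> A (z + w).
Proof.
move=> Az Aw; rewrite -[w]opprK; apply: (subringB ringA) => //.
by rewrite -sub0r; apply: (subringB ringA) => //; apply: subring0.
Qed.

Lemma subring_sum (I : Type) (s : seq I) (w : I -> F) :
  (forall i, A (w i)) -> A (\sum_(i <- s) w i).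
Proof. by move=> Aw; elim/big_ind: _ => //; [exact: subring0|exact: subringD]. Qed.

Lemma subringX z n : A z -> A (z ^+ n).
Proof.
move=> Az; elim: n => [|n IHn]; first exact: (subring1 ringA).
by rewrite exprS; apply: (subringM ringA).
Qed.

Definition adjoin z : set F :=
  [set w | exists2 p : {poly F}, (forall i, A p`_i) & w = p.[z]].

Lemma adjoin_ring z : is_subring (adjoin z).
Proof.
split.
- exists 1; rewrite ?hornerC // => i; rewrite coefC; case: ifP => _.
    exact: (subring1 ringA).
  exact: subring0.
- move=> _ _ [p Ap ->] [p' Ap' ->]; exists (p - p'); last by rewrite hornerD hornerN.
  by move=> i; rewrite coefB; apply: (subringB ringA).
move=> _ _ [p Ap ->] [p' Ap' ->]; exists (p * p'); last by rewrite hornerM.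
by move=> i; rewrite coefM; apply: subring_sum => l; apply: (subringM ringA).
Qed.

Lemma sub_adjoin z : A `<=` adjoin z.
Proof.
move=> w Aw; exists w%:P; last by rewrite hornerC.
by move=> i; rewrite coefC; case: ifP => _ //; exact: subring0.
Qed.

Lemma mem_adjoin z : adjoin z z.
Proof.
exists 'X; last by rewrite hornerX.
by move=> i; rewrite coefX; case: eqP => _; [exact: (subring1 ringA)|exact: subring0].
Qed.

End SubringTheory.

Lemma exists_maximal_subring A w : is_subring A -> ~ A w ->
  exists B, [/\ is_subring B, A `<=` B, ~ B w &
    forall z, ~ B z -> adjoin B z w].
Proof.
move=> ringA nAw; pose good B := [/\ is_subring B, A `<=` B & ~ B w].
have [|B [PB maxB]] := @Zorn_bigcup F [set B | B = set0 \/ good B].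
  move=> C Cgood Ctot; have Cring D z : C D -> D z -> good D.
    by move=> /Cgood[-> //|].
  have [[B0 CB0 [ringB0 sAB0 _]]|nC] := pselect (exists2 B, C B & good B).
    have common z z' : (\bigcup_(X in C) X) z -> (\bigcup_(X in C) X) z' ->
        exists2 D, C D & [/\ D z, D z' & is_subring D].
      move=> [B CB Bz] [B' CB' Bz'].
      have [ringB _ _] := Cring _ _ CB Bz; have [ringB' _ _] := Cring _ _ CB' Bz'.
      case: (Ctot _ _ CB CB') => sub; [exists B'|exists B] => //.
        by split=> //; apply: sub.
      by split=> //; apply: sub.
    right; split=> [|z /sAB0 Bz|[B CB Bw]]; last 2 first.
    - by exists B0.
    - by have [_ _] := Cring _ _ CB Bw.
    split=> [|z z' Uz Uz'|z z' Uz Uz']; first by exists B0 => //; apply: subring1.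
      have [D CD [Dz Dz' ringD]] := common _ _ Uz Uz'; exists D => //.
      exact: subringB.
    have [D CD [Dz Dz' ringD]] := common _ _ Uz Uz'; exists D => //.
    exact: subringM.
  left; apply/seteqP; split=> // z [B CB Bz]; case: nC; exists B => //.
  exact: Cring Bz.
have {PB} [B0|[ringB sAB nBw]] := PB.
  case: (maxB A); last by right; split.
  rewrite B0; split=> [_ []|].
  by move/(_ 1 (subring1 ringA)).
exists B; split=> // z nBz; apply: contrapT => nw.
apply: (maxB (adjoin B z)).
  split; first exact: sub_adjoin.
  by move/(_ z (mem_adjoin ringB z)).
right; split=> //; first exact: adjoin_ring.
by move=> a /sAB; apply: sub_adjoin.
Qed.

(** * Maximal subrings avoiding the inverse of [tau] are valuation rings *)

Section Valuative.
Variables (A : set F) (tau : F).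
Hypotheses (ringA : is_subring A) (Atau : A tau) (nAtau : ~ A tau^-1).
Hypothesis maxA : forall z, ~ A z -> adjoin A z tau^-1.

Let tau_neq0 : tau != 0.
Proof.
by apply/eqP=> tau0; apply: nAtau; rewrite tau0 invr0; apply: (subring0 ringA).
Qed.

(** Otherwise maximality writes [tau^-1] as a polynomial in u^-1, where u = 1 - tau b. Multiplying
    by u^n clears the denominators, and u^n is 1 modulo tau, so [tau^-1] itself would lie in [A]. *)
Lemma subring_unit b : A b -> A (1 - tau * b)^-1.
Proof.
move=> Ab; set u := 1 - tau * b; apply: contrapT => nAu.
have un0 : u != 0.
  by apply/eqP=> u0; apply: nAu; rewrite u0 invr0; apply: (subring0 ringA).
have [p Ap tauE] := maxA nAu; pose n := size p.
have Au : A u.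
  by apply: subringB ringA _ _ (subring1 ringA) _ => //; apply: (subringM ringA).
have [b' Ab' uE] : exists2 b', A b' & u ^+ n = 1 - tau * b'.
  elim: n => [|n [b' Ab' IHn]].
    by exists 0; [exact: (subring0 ringA) | rewrite mulr0 subr0].
  exists (b + u * b'); first by apply: (subringD ringA) => //; apply: (subringM ringA).
  by rewrite exprS IHn /u; ring.
apply: nAtau; have -> : tau^-1 = u ^+ n * tau^-1 + b'.
  by rewrite uE mulrBl mul1r mulrAC divff // mul1r subrK.
apply: (subringD ringA) => //; rewrite tauE horner_coef mulr_sumr.
apply: (subring_sum ringA) => //.
move=> i; rewrite mulrCA; apply: (subringM ringA) => //.
rewrite exprVn -[n](subnK (ltnW (ltn_ord i))) exprD mulfK ?expf_neq0 //.
exact: (subringX ringA).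
Qed.

Definition short_relation z n :=
  exists p : {poly F}, [/\ forall i, A p`_i, (size p <= n)%N & tau * p.[z] = 1].

(* Dividing the second relation by the unit 1 - tau q_0 expresses z^n through
   lower powers, multiplied by tau. *)
Lemma short_relation_reduce z n k : (k <= n)%N -> z != 0 ->
  short_relation z n.+1 -> short_relation z^-1 k.+1 -> short_relation z n.
Proof.
move=> le_kn nz [p [Ap szp pz]] [q [Aq szq qz]].
set u := 1 - tau * q`_0; have Au := subring_unit (Aq 0%N).
have un0 : u != 0.
  apply/eqP => /subr0_eq tq; apply: nAtau.
  by rewrite -[tau^-1]mulr1 tq mulKf.
pose a := p`_n * tau / u.
have Aa : A a by apply: (subringM ringA) => //; apply: (subringM ringA).
exists (\poly_(i < n) (p`_i + a * q`_(n - i))); split=> [i||].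
- rewrite coef_poly; case: ifP => _; last exact: (subring0 ringA).
  by apply: (subringD ringA) => //; apply: (subringM ringA).
- exact: size_poly.
rewrite -pz; congr (_ * _); rewrite horner_poly (horner_coef_wide _ szp) big_ord_recr /=.
rewrite (eq_bigr (fun i : 'I_n => p`_i * z ^+ i + a * (q`_(n - i) * z ^+ i))); last first.
  by move=> i _; rewrite mulrDl mulrA.
rewrite big_split /= -mulr_sumr; congr (_ + _).
have szq' : (size q <= n.+1)%N by apply: leq_trans szq _.
have : q.[z^-1] = tau^-1 by apply: (mulfI tau_neq0); rewrite qz divff.
rewrite (horner_coef_wide _ szq') big_ord_recl expr0 mulr1 => /(canRL (addKr _)).
rewrite addrC => qE.
have -> : \sum_(i < n) q`_(n - i) * z ^+ i = z ^+ n * (tau^-1 - q`_0).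
  rewrite -qE mulr_sumr (reindex_inj rev_ord_inj) /=; apply: eq_bigr => i _.
  rewrite subKn // /bump add1n mulrCA exprVn.
  have -> : z ^+ n = z ^+ (n - i.+1) * z ^+ i.+1 by rewrite -exprD subnK.
  by rewrite mulfK ?expf_neq0.
have -> : tau^-1 - q`_0 = tau^-1 * u by rewrite mulrBr mulr1 mulKf.
by rewrite /a; field; apply/andP.
Qed.

(** If both memberships fail, maximality gives a short relation for z and one for z^-1. Reducing the
    longer one by the other lowers the total length until a relation of length 0 would say 0 = 1. *)
Lemma maximal_subring_total z : A z \/ A z^-1.
Proof.
apply: contrapT => /not_orP[nAz nAzi].
have nz : z != 0 by apply/eqP=> z0; apply: nAz; rewrite z0; apply: (subring0 ringA).
have rel w : ~ A w -> exists n, short_relation w n.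
  by move=> /maxA[p Ap pE]; exists (size p), p; rewrite -pE divff.
have [[n Rn] [k Rk]] := (rel _ nAz, rel _ nAzi).
have nrel0 w : ~ short_relation w 0.
  case=> p [_]; rewrite leqn0 size_poly_eq0 => /eqP->.
  by rewrite horner0 mulr0 => /eqP; rewrite eq_sym oner_eq0.
have [d] := ubnP (n + k); elim: d => // d IHd in n k Rn Rk *.
case: n k Rn Rk => [|n] [|k] Rn Rk; try by [case: (nrel0 _ Rn)|case: (nrel0 _ Rk)].
rewrite !ltnS => le_nk; have [le_kn|/ltnW le_kn] := leqP k n.
  by apply: (IHd n k.+1) => //; apply: short_relation_reduce Rn Rk.
apply: (IHd n.+1 k) => //; last by rewrite addSnnS.
by apply: short_relation_reduce le_kn _ Rk _; rewrite ?invr_eq0 ?invrK.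
Qed.

End Valuative.

(* A maximal subring among those not containing tau^-1 is a valuation ring. *)
Lemma exists_place (K : fieldType) (c : {rmorphism K -> F}) A tau :
  is_subring A -> (forall a, A (c a)) -> A tau -> ~ A tau^-1 ->
  exists2 P : place c, A `<=` vring P & place_ideal P tau.
Proof.
move=> ringA Ac Atau nAtau.
have [B [ringB sAB nB maxB]] := exists_maximal_subring ringA nAtau.
have valB : is_valuation_ring c B.
  split.
  - by move=> a; apply: sAB.
  - exact: subringB.
  - exact: subringM.
  - exists tau; first exact: sAB.
    by move=> a tauE; apply: nAtau; rewrite tauE -fmorphV; apply: Ac.
  - by exists tau^-1.
  exact: maximal_subring_total (sAB _ Atau) nB maxB.
exists (Place valB) => //=; split; first exact: sAB.
by case.
Qed.

End PlaceExistence.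

Lemma fraction_quotient (R : idomainType) (g : {fraction R}) :
  exists2 pq : R * R, pq.2 != 0 & g = tofrac pq.1 / tofrac pq.2.
Proof.
elim/quotW: g => f; have nd := denom_ratioP f; exists (\n_f, \d_f) => //=.
apply: (canRL (mulfK _)); first by rewrite tofrac_eq0.
rewrite -[LHS]/(FracField.mul _ _) !piE /FracField.mulf.
apply/eqmodP; rewrite /= FracField.equivfE !numden_Ratio ?mulf_neq0 ?oner_eq0 //.
by rewrite !mulr1 mulrC.
Qed.

(** * Places above the projective line *)

Section RationalSubfield.
Variables (K : closedFieldType) (L : fieldExtType (ratfun K)).
Local Notation x := (ext_x L).
Local Notation cst := (ext_const L).
Local Notation iota := (in_alg L).
Implicit Types (a b : K) (s : seq K) (g : ratfun K).

Definition lin b : L := x - cst b.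

Lemma iota_XsubC b : iota (tofrac ('X - b%:P)) = lin b.
Proof. by rewrite rmorphB rmorphB. Qed.

Lemma lin_neq0 b : lin b != 0.
Proof. by rewrite -iota_XsubC fmorph_eq0 tofrac_eq0 polyXsubC_eq0. Qed.

Lemma x_neq0 : x != 0.
Proof. by have := lin_neq0 0; rewrite /lin rmorph0 subr0. Qed.

Lemma lin_sub a b : lin a = lin b + cst (b - a).
Proof. by rewrite /lin rmorphB addrA subrK. Qed.

Lemma prod_lin_neq0 s : \prod_(b <- s) lin b != 0.
Proof. by rewrite prodf_seq_neq0; apply/allP=> b _; apply: lin_neq0. Qed.

Definition linear_factors g (s : seq K * seq K) : Prop :=
  exists2 a, a != 0 & iota g = cst a * \prod_(b <- s.1) lin b / \prod_(b <- s.2) lin b.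

(* A choice of one factorization; numerator and denominator need not be
   coprime, so only the differences in deg and ord are meaningful. *)
Definition factors g : seq K * seq K := xget ([::], [::]) (linear_factors g).

Lemma iota_prod_XsubC s :
  iota (tofrac (\prod_(b <- s) ('X - b%:P))) = \prod_(b <- s) lin b.
Proof. by rewrite !rmorph_prod; apply: eq_bigr => b _; apply: iota_XsubC. Qed.

Lemma factorsP g : g != 0 -> linear_factors g (factors g).
Proof.
move=> ng; apply: xgetPex; have [[p q] /= nq gE] := fraction_quotient g.
have np : p != 0 by apply: contra_neq ng => p0; rewrite gE p0 tofrac0 mul0r.
have split (h : {poly K}) : h != 0 -> exists s a,
    a != 0 /\ iota (tofrac h) = cst a * \prod_(b <- s) lin b.
  move=> nh; have [s hE] := closed_field_poly_normal h.
  exists s, (lead_coef h); rewrite lead_coef_eq0; split=> //.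
  rewrite -iota_prod_XsubC -[cst _]/(iota (tofrac _)) -rmorphM -tofracM.
  by rewrite mul_polyC -hE.
have [s1 [a1 [na1 pE]]] := split _ np; have [s2 [a2 [na2 qE]]] := split _ nq.
exists (s1, s2), (a1 / a2); first by rewrite mulf_neq0 ?invr_eq0.
rewrite gE [LHS](_ : _ = iota (tofrac p) / iota (tofrac q)); last exact: fmorph_div.
by rewrite pE qE [cst (_ / _)]fmorph_div invfM mulrACA -!mulrA.
Qed.

Definition deg g : int := (size (factors g).1)%:Z - (size (factors g).2)%:Z.
Definition ord b g : int :=
  (count_mem b (factors g).1)%:Z - (count_mem b (factors g).2)%:Z.

(** * Places above a point of the affine line *)

Section FinitePlace.
Variables (P : place cst) (b : K).
Hypothesis P_b : place_ideal P (lin b).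

Lemma finite_vring_x : vring P x.
Proof. by rewrite -[x](subrK (cst b)); apply: vringD (vring_cst _ _); case: P_b. Qed.

Lemma finite_lin a : a != b -> place_unit P (lin a).
Proof.
move=> nab; rewrite (lin_sub a b) addrC; apply: punitD_pideal => //.
by apply: punit_cst; rewrite subr_eq0 eq_sym.
Qed.

Lemma finite_prod_lin s :
  place_unit P (\prod_(a <- s) lin a / lin b ^+ count_mem b s).
Proof.
elim: s => [|a s IHs]; first by rewrite big_nil divr1; apply: punit1.
rewrite big_cons /=; have [->|nab] := eqVneq a b.
  by rewrite add1n exprS invfM mulrACA divff ?mul1r // lin_neq0.
rewrite add0n -mulrA; apply: punitM => //.
exact: finite_lin.
Qed.

Lemma finite_ord g : g != 0 -> place_unit P (iota g / lin b ^ ord b g).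
Proof.
move=> /factorsP[a na ->]; rewrite /ord expfzDr ?lin_neq0 // -invr_expz -!exprnP.
set p := \prod_(b0 <- _) _; set q := \prod_(b0 <- _) _.
set u := lin b ^+ _; set v := lin b ^+ _.
have -> : cst a * p / q / (u / v) = cst a * (p / u) * (q / v)^-1.
  by rewrite !invf_div; ring.
apply: punitM; last by apply: punitV; apply: finite_prod_lin.
by apply: punitM; [apply: punit_cst | apply: finite_prod_lin].
Qed.

(* In a relation sum_i p_i z^i = 0 over K(x) two nonzero terms are associated,
   so z^(i - k) is associated to an element of K(x). *)
Lemma finite_commensurable (z : L) : z != 0 ->
  exists n : int, place_unit P (z ^+ (\dim {:L})`! / lin b ^ n).
Proof.
move=> nz; have /polyOver1P[p pE] := minPolyOver 1 z.
have szp : (size p = (adjoin_degree 1 z).+1)%N.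
  by rewrite -(size_map_poly (in_alg L)) -pE size_minPoly.
have lep : (adjoin_degree 1 z <= \dim {:L})%N.
  by have := dim_Fadjoin 1 z; rewrite dimv1 muln1 => <-; apply: dimvS (subvf _).
pose w (i : 'I_(size p)) := iota p`_i * z ^+ i.
have sumw : \sum_i w i = 0.
  rewrite -[RHS](minPolyxx 1 z) pE horner_coef size_map_poly.
  by apply: eq_bigr => i _; rewrite coef_map.
have nw : exists i, w i != 0.
  have szp_gt0 : ((size p).-1 < size p)%N by rewrite szp.
  exists (Ordinal szp_gt0); rewrite mulf_neq0 ?expf_neq0 // fmorph_eq0.
  by rewrite -lead_coefE lead_coef_eq0 -size_poly_eq0 szp.
have [i [k [nik nwi nwk Uik]]] : exists i k,
    [/\ i != k, w i != 0, w k != 0 & place_unit P (w i / w k)].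
  apply: contrapT => nex; have [|i [_ Ui _]] := @sum_dominant _ _ _ P _ w nw.
    by move=> i k nik nwi nwk Uik; apply: nex; exists i, k.
  by case: Ui; rewrite sumw mul0r eqxx.
wlog ltki : i k nik nwi nwk Uik / (k < i)%N.
  move=> IH; have [||eik] := ltngtP k i; first exact: IH.
    move=> ltik; apply: (IH k i) => //; first by rewrite eq_sym.
    by rewrite -invf_div; apply: punitV.
  by case/eqP: nik; apply: val_inj.
have np (l : 'I_(size p)) : w l != 0 -> p`_l != 0.
  by rewrite mulf_eq0 negb_or fmorph_eq0 => /andP[].
have Ui := finite_ord (np i nwi); have Uk := finite_ord (np k nwk).
set oi := ord b _ in Ui; set ok := ord b _ in Uk.
have le_i : (i - k <= \dim {:L})%N.
  apply: leq_trans lep; rewrite -ltnS -szp; apply: leq_ltn_trans (ltn_ord i).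
  exact: leq_subr.
(* The exponent i - k depends on z but never exceeds the degree of [L]; the factorial of that degree
   is a common multiple, giving the uniform exponent that [exists_uniformizer] requires. *)
have /dvdnP[M dimE] : ((i - k)%N %| (\dim {:L})`!)%N.
  by apply: dvdn_fact; rewrite subn_gt0 ltki.
exists ((ok - oi) * M%:Z).
have -> : z ^+ (\dim {:L})`! / lin b ^ ((ok - oi) * M%:Z)
        = (z ^+ (i - k) / lin b ^ (ok - oi)) ^+ M.
  by rewrite dimE mulnC exprM -exprz_exp -exprnP exprMn exprVn.
apply: punitX; rewrite expfzDr ?lin_neq0 // -invr_expz.
have -> : z ^+ (i - k) / (lin b ^ ok / lin b ^ oi)
    = (w i / w k) * (iota p`_k / lin b ^ ok) * (iota p`_i / lin b ^ oi)^-1.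
  have fieldE (B C u v d f : L) : B != 0 -> C != 0 -> u != 0 -> v != 0 -> f != 0 ->
      d / (u / v) = C * (d * f) / (B * f) * (B / u) * (C / v)^-1.
    by move=> *; field; do ?[apply/andP; split].
  have -> : w i = iota p`_i * (z ^+ (i - k) * z ^+ k) by rewrite -exprD subnK // ltnW.
  by apply: fieldE; rewrite ?fmorph_eq0 ?np ?expfz_neq0 ?lin_neq0 ?expf_neq0.
by apply: punitM; [apply: punitM | apply: punitV].
Qed.

Lemma finite_vring_valuation (z : L) : z != 0 -> 0 <= valuation P z -> vring P z.
Proof.
exact: (vring_valuation (lin_neq0 b) P_b (fact_gt0 _) finite_commensurable).
Qed.

End FinitePlace.

(** Apply [exists_place] to the ring K[x]: it does not contain the inverse of x - b, since
    evaluating p (X - b) = 1 at b gives 0 = 1. *)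
Lemma exists_finite_place b : exists P : place cst, place_ideal P (lin b).
Proof.
pose A := [set z : L | exists p : {poly K}, z = iota (tofrac p)].
have ringA : is_subring A.
  split; first by exists 1; rewrite !rmorph1.
    by move=> _ _ [p ->] [p' ->]; exists (p - p'); rewrite !rmorphB.
  by move=> _ _ [p ->] [p' ->]; exists (p * p'); rewrite !rmorphM.
have [||| P _ MP] := @exists_place L K cst A (lin b) ringA.
- by move=> a; exists a%:P.
- by exists ('X - b%:P); rewrite iota_XsubC.
- case=> p /(congr1 (fun z => z * lin b)); rewrite mulVf ?lin_neq0 //.
  rewrite -iota_XsubC -!rmorphM -(rmorph1 (in_alg L)) => /fmorph_inj/eqP.
  rewrite -tofrac1 tofrac_eq => /eqP/(congr1 (horner^~ b)).
  by rewrite hornerC hornerM hornerXsubC subrr mulr0 => /eqP; rewrite oner_eq0.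
by exists P.
Qed.

(** * Places above the pole of x *)

Section InfinitePlace.
Variable P : place cst.
Hypothesis P_inf : place_ideal P x^-1.

Lemma infinite_lin a : place_unit P (lin a / x).
Proof.
rewrite /lin mulrBl divff ?x_neq0 //; apply: punitD_pideal; first exact: punit1.
rewrite -mulNr mulrC; apply: pidealM => //.
by apply: vringN; apply: vring_cst.
Qed.

Lemma infinite_prod_lin s : place_unit P (\prod_(a <- s) lin a / x ^+ size s).
Proof.
elim: s => [|a s IHs]; first by rewrite big_nil divr1; apply: punit1.
rewrite big_cons exprS invfM mulrACA; apply: punitM => //; exact: infinite_lin.
Qed.

Lemma infinite_deg g : g != 0 -> place_unit P (iota g / x ^ deg g).
Proof.
move=> /factorsP[a na ->]; rewrite /deg expfzDr ?x_neq0 // -invr_expz -!exprnP.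
set p := \prod_(b0 <- _) _; set q := \prod_(b0 <- _) _.
set u := x ^+ _; set v := x ^+ _.
have -> : cst a * p / q / (u / v) = cst a * (p / u) * (q / v)^-1.
  by rewrite !invf_div; ring.
apply: punitM; last by apply: punitV; apply: infinite_prod_lin.
by apply: punitM; [apply: punit_cst | apply: infinite_prod_lin].
Qed.

End InfinitePlace.
End RationalSubfield.

(** * Roots listed with multiplicity *)

Section RootSequence.
Variables (T : eqType) (r : nat) (alpha : 'I_r -> T).
Implicit Types e : 'I_r -> nat.

(** Turns a product of powers over the index [i] into a product over a sequence, the shape in which
    [factors] presents rational functions. *)
Definition root_seq e : seq T :=
  flatten [seq nseq (e i) (alpha i) | i <- index_enum 'I_r].

Lemma prod_root_seq (R : comNzRingType) (F : T -> R) e :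
  \prod_(b <- root_seq e) F b = \prod_i F (alpha i) ^+ e i.
Proof.
rewrite /root_seq big_flatten /= big_map; apply: eq_bigr => i _.
by rewrite big_nseq -Monoid.iteropE.
Qed.

Lemma size_root_seq e : size (root_seq e) = (\sum_i e i)%N.
Proof.
rewrite size_flatten /shape -map_comp sumnE big_map.
by apply: eq_bigr => i _; rewrite /= size_nseq.
Qed.

Lemma count_root_seq b e :
  count_mem b (root_seq e) = (\sum_(i | alpha i == b) e i)%N.
Proof.
rewrite count_flatten -map_comp sumnE big_map [RHS]big_mkcond.
by apply: eq_bigr => i _; rewrite /= count_nseq /=; case: eqP; rewrite ?mul1n.
Qed.

End RootSequence.

(** The explicit form of H(Q), with the subtracted sum moved to the left to avoid truncation. All j
    are allowed, not only j < m, which makes closure under addition direct. *)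
Definition floor_semigroup (m r : nat) (lambda : 'I_r -> nat) : set nat :=
  [set N | exists j a, (N + m * \sum_i (j * lambda i %/ m)
                        = m * a + lambda_sum lambda * j)%N].

(** * The Kummer extension *)

Section Kummer.
Variables (K : closedFieldType) (L : fieldExtType (ratfun K)) (y : L).
Variables (m r : nat) (alpha : 'I_r -> K) (lambda : 'I_r -> nat).
Hypothesis m_gt0 : (0 < m)%N.
Hypothesis coprime_m : coprime m (lambda_sum lambda).
Hypothesis L_gen : <<1; y>>%VS = fullv.
Hypothesis curve_eq :
  y ^+ m = \prod_(i < r) (ext_x L - ext_const L (alpha i)) ^+ lambda i.
Local Notation x := (ext_x L).
Local Notation cst := (ext_const L).
Local Notation iota := (in_alg L).
Local Notation lambda0 := (lambda_sum lambda).

Lemma curve_lin : y ^+ m = \prod_(b <- root_seq alpha lambda) lin L b.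
Proof. by rewrite prod_root_seq curve_eq. Qed.

Lemma y_neq0 : y != 0.
Proof.
have := prod_lin_neq0 L (root_seq alpha lambda).
by rewrite -curve_lin expf_eq0 m_gt0.
Qed.

Lemma infinite_curve (P : place cst) : place_ideal P x^-1 ->
  place_unit P (y ^+ m / x ^+ lambda0).
Proof.
move=> Px; rewrite curve_lin /lambda_sum -(size_root_seq alpha).
exact: infinite_prod_lin.
Qed.

(** The same t works at every place above infinity; this is what later allows two such places to be
    compared. *)
Lemma exists_infinite_parameter : exists2 t : L, t != 0 &
  forall P : place cst, place_ideal P x^-1 ->
    [/\ place_unit P (x * t ^+ m), place_unit P (y * t ^+ lambda0)
      & place_ideal P t].
Proof.
have [a b bezout _] := egcdnP lambda0 m_gt0.
rewrite (eqP coprime_m) in bezout.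
have nx := x_neq0 L; have ny := y_neq0.
(* Bezout reads a m = b lambda0 + 1, so with orders -m for x and -lambda0 for y this quotient has
   order 1. *)
exists (y ^+ b / x ^+ a); first by rewrite mulf_neq0 ?invr_eq0 ?expf_neq0.
move=> P Px; have Uf := infinite_curve Px.
have xt : x * (y ^+ b / x ^+ a) ^+ m = (y ^+ m / x ^+ lambda0) ^+ b.
  rewrite !exprMn !exprVn -!exprM bezout addn1 exprS (mulnC b m) (mulnC b).
  by rewrite invfM mulrCA mulVKf.
have Ux : place_unit P (x * (y ^+ b / x ^+ a) ^+ m).
  by rewrite xt; apply: punitX.
split=> //.
  apply: (punit_root m_gt0); rewrite exprMn exprAC.
  have -> : y ^+ m * (y ^+ b / x ^+ a) ^+ m ^+ lambda0
     = (y ^+ m / x ^+ lambda0) * (x * (y ^+ b / x ^+ a) ^+ m) ^+ lambda0.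
    by rewrite [in RHS]exprMn mulrA divfK ?expf_neq0.
  by apply: punitM => //; apply: punitX.
set t := y ^+ b / x ^+ a in Ux *.
have tm : place_ideal P (t ^+ m).
  rewrite -[t ^+ m](mulKf nx); apply: pidealM => //.
  exact: punit_vring.
have Ot := vring_root m_gt0 (pideal_vring tm).
case: (vring_case Ot) => // Ut; case: tm => _ []; exact: punitX.
Qed.

(** The pole order at infinity of the function g(x) y^j. *)
Definition term_degree (g : ratfun K) (j : nat) : int :=
  m%:Z * deg L g + lambda0%:Z * j%:Z.

(** * Expansions in powers of [y] at infinity, and uniqueness of the place there *)

Section Infinity.
Variable t : L.
Hypothesis t_neq0 : t != 0.
Hypothesis t_param : forall P : place cst, place_ideal P x^-1 ->
  [/\ place_unit P (x * t ^+ m), place_unit P (y * t ^+ lambda0)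
    & place_ideal P t].

Lemma infinite_term (P : place cst) g j : place_ideal P x^-1 -> g != 0 ->
  place_unit P (iota g * y ^+ j * t ^ term_degree g j).
Proof.
move=> Px ng; have [Ux Uy _] := t_param Px; have Ug := infinite_deg Px ng.
have -> : iota g * y ^+ j * t ^ term_degree g j
    = (iota g / x ^ deg L g) * (x * t ^+ m) ^ deg L g * (y * t ^+ lambda0) ^+ j.
  have fieldE (G Y T T' X : L) : X != 0 ->
      G * Y * (T * T') = G / X * (X * T) * (Y * T').
    by move=> nX; field.
  rewrite /term_degree expfzDr // expfzMl [(y * _) ^+ j]exprMn.
  rewrite -[t ^ (m%:Z * _)]exprz_exp -[t ^ (lambda0%:Z * _)]exprz_exp -!exprnP.
  by apply: fieldE; rewrite expfz_neq0 ?x_neq0.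
by apply: punitM; [apply: punitM => //; apply: punitXz | apply: punitX].
Qed.

(** Modulo m, equal degrees give m | lambda0 (k - j); coprimality then contradicts 0 < k - j < m. *)
Lemma term_degree_inj g h (j k : 'I_m) : j != k ->
  term_degree g j <> term_degree h k.
Proof.
wlog ltjk : g h j k / (j < k)%N.
  move=> IH njk; have [lt|lt|eq_jk] := ltngtP j k.
  - exact: IH.
  - by move=> /esym; apply: IH; rewrite // eq_sym.
  by case/eqP: njk; apply: val_inj.
move=> _ eq_deg.
have : (m %| lambda0 * (k - j))%N.
  apply/dvdnP; exists `|deg L g - deg L h|%N.
  by move: eq_deg; rewrite /term_degree; nia.
rewrite Gauss_dvdr // => /dvdn_leq; rewrite subn_gt0 ltjk => /(_ isT).
by rewrite leqNgt (leq_ltn_trans (leq_subr _ _)).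
Qed.

(** Terms of different degree are never associated, so [sum_dominant] applies: the pole order of the
    sum is the largest term degree. *)
Lemma infinite_dominant (P : place cst) (g : 'I_m -> ratfun K) :
  place_ideal P x^-1 -> (exists j, g j != 0) ->
  exists j, [/\ g j != 0,
    place_unit P ((\sum_(k < m) iota (g k) * y ^+ k) * t ^ term_degree (g j) j)
    & forall k, g k != 0 -> term_degree (g k) k <= term_degree (g j) j].
Proof.
move=> Px [j0 nj0]; have [_ _ Mt] := t_param Px.
pose w (k : 'I_m) := iota (g k) * y ^+ k; pose e (k : 'I_m) := term_degree (g k) k.
have nw k : (w k != 0) = (g k != 0).
  by rewrite mulf_eq0 negb_or fmorph_eq0 expf_neq0 ?andbT // y_neq0.
have nt n : t ^ n != 0 by rewrite expfz_neq0.
have Uw k : g k != 0 -> place_unit P (w k * t ^ e k) by apply: infinite_term.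
have ratio i k : g i != 0 -> g k != 0 ->
    exists2 u, place_unit P u & w i / w k = t ^ (e k - e i) * u.
  move=> ni nk; exists ((w i * t ^ e i) / (w k * t ^ e k)).
    by apply: punitM; [apply: Uw | apply/punitV/Uw].
  have fieldE (A B T S : L) : B != 0 -> T != 0 -> S != 0 ->
      A / B = S / T * ((A * T) / (B * S)).
    by move=> *; field; do ?[apply/andP; split].
  by rewrite expfzDr // -invr_expz; apply: fieldE; rewrite ?nw.
have [||j [nj Uj Oj]] := @sum_dominant _ _ _ P _ w.
- by exists j0; rewrite nw.
- move=> i k nik; rewrite !nw => ni nk; have [u Uu ->] := ratio i k ni nk.
  move=> Uik; have := term_degree_inj (g := g i) (h := g k) nik; apply.
  apply/esym/eqP; rewrite -subr_eq0; apply/eqP/(punit_exprz Mt).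
  by rewrite -[_ ^ _](mulfK (punit_neq0 Uu)); apply: punitM => //; apply: punitV.
exists j; split; first by rewrite -nw.
  have -> : (\sum_k w k) * t ^ e j = (\sum_k w k) / w j * (w j * t ^ e j).
    by rewrite mulrA divfK.
  by apply: punitM => //; apply: Uw; rewrite -nw.
rewrite nw in nj; move=> k nk; have [u Uu wE] := ratio k j nk nj.
rewrite -subr_ge0; apply: (vring_exprz t_neq0 Mt).
apply: (vring_punitM Uu); rewrite -wE; apply: Oj.
Qed.

Lemma minPoly_y_dvdp : minPoly 1 y %| 'X^m - (y ^+ m)%:P.
Proof.
apply: minPoly_dvdp; last by rewrite /root !hornerE subrr.
pose f : ratfun K := \prod_i tofrac ('X - (alpha i)%:P) ^+ lambda i.
have -> : y ^+ m = iota f.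
  rewrite curve_eq rmorph_prod; apply: eq_bigr => i _.
  by rewrite rmorphXn; congr (_ ^+ _); apply/esym/iota_XsubC.
by rewrite rpredB ?rpredX ?polyOverX // polyOverC rpredZ ?rpred1.
Qed.

Lemma adjoin_degree_y : (adjoin_degree 1 y <= m)%N.
Proof.
have := dvdp_leq _ minPoly_y_dvdp; rewrite size_minPoly size_XnsubC //; apply.
by rewrite -size_poly_eq0 size_XnsubC.
Qed.

Lemma basis_decomposition (z : L) :
  exists g : 'I_m -> ratfun K, z = \sum_(j < m) iota (g j) * y ^+ j.
Proof.
have /polyOver1P[p pE] := Fadjoin_polyOver 1 y z.
exists (fun j => p`_j).
have <- : (Fadjoin_poly 1 y z).[y] = z by apply: Fadjoin_poly_eq; rewrite L_gen memvf.
rewrite (@horner_coef_wide _ m) => [|]; last first.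
  exact: leq_trans (size_Fadjoin_poly _ _ _) adjoin_degree_y.
by apply: eq_bigr => i _; rewrite pE coef_map.
Qed.

Definition basis_sum (g : 'I_m -> ratfun K) : L := \sum_(j < m) iota (g j) * y ^+ j.

Lemma basis_sum0 (g : 'I_m -> ratfun K) : (forall j, g j = 0) -> basis_sum g = 0.
Proof. by move=> g0; apply: big1 => j _; rewrite g0 rmorph0 mul0r. Qed.

Lemma basis_sum_neq0 (g : 'I_m -> ratfun K) : basis_sum g != 0 -> exists j, g j != 0.
Proof.
move=> ng; apply: contrapT => g0; case/eqP: ng; apply: basis_sum0 => j.
by apply: contrapT => /eqP nj; apply: g0; exists j.
Qed.

(** The largest term degree e depends only on the coefficients of z, not on the place. Regularity at
    P forces e <= 0, and this gives regularity at Q. *)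
Lemma infinite_place_sub (P Q : place cst) :
  place_ideal P x^-1 -> place_ideal Q x^-1 -> vring P `<=` vring Q.
Proof.
move=> Px Qx z Oz; have [->|nz] := eqVneq z 0; first exact: vring0.
have [g zE] := basis_decomposition z.
have ng : exists j, g j != 0 by apply: basis_sum_neq0; rewrite /basis_sum -zE.
have [i [ni Ui maxi]] := infinite_dominant Px ng.
have [k [nk Uk maxk]] := infinite_dominant Qx ng.
have eq_ik : term_degree (g i) i = term_degree (g k) k.
  by apply/eqP; rewrite eq_le maxi ?maxk.
rewrite -zE in Ui; rewrite -zE -eq_ik in Uk; set e := term_degree _ _ in Ui Uk.
have [_ _ Mt] := t_param Px; have [_ _ Mt'] := t_param Qx.
have e_le0 : 0 <= - e.
  apply: (vring_exprz t_neq0 Mt); apply: (vring_punitM Ui).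
  by rewrite mulrCA -expfzDr // addNr expr0z mulr1.
have -> : z = z * t ^ e * t ^ (- e) by rewrite -mulrA -expfzDr // subrr mulr1.
by apply: vringM (punit_vring Uk) _; apply: vringXz => //; apply: pideal_vring.
Qed.

Lemma infinite_place_unique (P Q : place cst) :
  place_ideal P x^-1 -> place_ideal Q x^-1 -> P = Q.
Proof.
move=> Px Qx; have : vring P = vring Q.
  by apply/seteqP; split; apply: infinite_place_sub.
case: P Q {Px Qx} => [O OP] [O' OP'] /= eqO; case: _ / eqO in OP' *.
by congr Place; apply: Prop_irrelevance.
Qed.

(** Each nonzero z is t^(-e) times a unit, with e its largest term degree; membership in the ideal
    forces -e >= 1, so t divides z. *)
Lemma infinite_uniformizer (P : place cst) : place_ideal P x^-1 -> uniformizer P t.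
Proof.
move=> Px; have [_ _ Mt] := t_param Px; apply/seteqP; split=> [z Mz|z [w Ow ->]] /=.
  have [->|nz] := eqVneq z 0; first by exists 0; [exact: vring0|rewrite mulr0].
  have [g zE] := basis_decomposition z.
  have [|i [_]] := @infinite_dominant P g Px.
    by apply: basis_sum_neq0; rewrite /basis_sum -zE.
  rewrite -zE; set e := term_degree _ _ => Ui _.
  have e_lt0 : 1 <= - e.
    rewrite -gtz0_ge1 oppr_gt0 ltNge; apply/negP => e_ge0.
    apply: (pideal_inv nz Mz); have -> : z^-1 = (z * t ^ e)^-1 * t ^ e.
      by rewrite invfM divfK // expfz_neq0.
    apply: vringM; first by apply/punit_vring/punitV.
    by apply: vringXz => //; apply: pideal_vring.
  exists (z / t); last by rewrite mulrC divfK.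
  have -> : z / t = (z * t ^ e) * t ^ (- e - 1).
    by rewrite -mulrA -expfzDr // addrA subrr sub0r.
  apply: vringM (punit_vring Ui) _; apply: vringXz; first exact: pideal_vring.
  by rewrite subr_ge0.
by apply: pidealM.
Qed.

Lemma infinite_valuation (P : place cst) (z : L) (e : int) : place_ideal P x^-1 ->
  place_unit P (z * t ^ e) -> valuation P z = - e.
Proof.
move=> Px U; apply: valuationE (infinite_uniformizer Px) U _.
by rewrite mulrCA -expfzDr // addNr mulr1.
Qed.

End Infinity.

Lemma floor_sub_weierstrass (Q : place cst) : place_ideal Q x^-1 ->
  floor_semigroup m lambda `<=` weierstrass_semigroup Q.
Proof.
move=> Qx s [j [a sE]].
pose e i := (j * lambda i %/ m)%N; pose d := \prod_(b <- root_seq alpha e) lin L b.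
have nd : d != 0 by apply: prod_lin_neq0.
(* The denominator is the largest product of powers of the x - alpha_i that keeps y^j / d regular on
   the affine part. The pole order of z at Q is m a + lambda0 j minus m times the floor sum, that
   is, s. *)
pose z := x ^+ a * y ^+ j / d; have nx := x_neq0 L; have ny := y_neq0.
have nz : z != 0 by rewrite !mulf_neq0 ?invr_eq0 ?expf_neq0.
have [t nt tP] := exists_infinite_parameter.
have vQ : valuation Q z = - s%:Z.
  apply: (infinite_valuation nt tP Qx).
  have [Ux Uy Mt] := tP Q Qx; have Ud := infinite_prod_lin Qx (root_seq alpha e).
  rewrite -/d size_root_seq in Ud; set n := (\sum_i _)%N in Ud.
  have ns : t ^+ s * t ^+ (m * n) = t ^+ (m * a) * t ^+ (lambda0 * j).
    by rewrite -!exprD sE.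
  have -> : z * t ^ s%:Z = (x * t ^+ m) ^+ a * (y * t ^+ lambda0) ^+ j
      * (d / x ^+ n)^-1 * (x * t ^+ m) ^- n.
    have fieldE (A B C D T T1 T2 T3 X : L) : D != 0 -> T1 != 0 -> X != 0 ->
      T * T1 = T2 * T3 ->
      A * B / D * T = (A * T2) * (B * T3) * (D / X)^-1 * (X * T1)^-1.
      move=> nD nT1 nX TE; have -> : T = T2 * T3 / T1 by rewrite -TE mulfK.
      by field; do ?[apply/andP; split].
    rewrite !exprMn -!exprM; apply: fieldE; rewrite ?expf_neq0 //.
  by apply: punitM; [apply: punitM; [apply: punitM|]|]; rewrite ?exprVn;
     do ?[apply: punitV]; try apply: punitX.
exists z => //; apply/funext => P; rewrite /pole_divisor /multiple_of_place.
case: asboolP => [->|nPQ]; first by rewrite vQ; lia.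
(* A pole of x at P would make P a place above infinity, hence equal to Q. *)
have Ox : vring P x.
  apply: contrapT => nOx; apply: nPQ; apply: (infinite_place_unique nt tP) => //.
  exact: nvring_pideal.
have Olin b : vring P (lin L b) by apply: vringB => //; apply: vring_cst.
have Oz : vring P z.
  (* In z^m the curve equation replaces y^m, leaving x - alpha_i with exponent j lambda_i - m
     floor(j lambda_i / m) >= 0. *)
  apply: (vring_root m_gt0); rewrite /z !exprMn exprVn exprAC.
  rewrite [y ^+ j ^+ m]exprAC curve_eq /d prod_root_seq -!prodrXl -mulrA -prodf_div.
  apply: vringM; first by do ?apply: vringX.
  apply: vring_prod => i _; rewrite -!exprM [(lambda i * j)%N]mulnC.
  have le_e : (e i * m <= j * lambda i)%N by apply: leq_divM.
  rewrite -(subnK le_e) exprD mulfK ?expf_neq0 ?lin_neq0 //.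
  exact: vringX (Olin (alpha i)).
have := valuation_ge0 Oz; lia.
Qed.


(** * The automorphisms y -> zeta y and regularity on the affine part *)

Section Conjugation.
Variables (P : place cst) (P_inf : place_ideal P x^-1).

(** A smaller degree would give a vanishing combination of 1, ..., y^(m-1) with a nonzero
    coefficient, which [infinite_dominant] excludes. *)
Lemma size_minPoly_y : size (minPoly 1 y) = m.+1.
Proof.
have [t nt tP] := exists_infinite_parameter.
rewrite size_minPoly; congr _.+1; apply/eqP; rewrite eqn_leq adjoin_degree_y /=.
rewrite leqNgt; apply/negP => lt_m.
have /polyOver1P[p pE] := minPolyOver 1 y.
have szp : (size p = (adjoin_degree 1 y).+1)%N.
  by rewrite -(size_map_poly (in_alg L)) -pE size_minPoly.
have [|j [_]] := infinite_dominant nt tP P_inf (g := fun j => p`_j).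
  exists (Ordinal lt_m); have := monic_minPoly 1 y.
  by rewrite pE map_monic monicE lead_coefE szp /= => /eqP->; apply: oner_neq0.
have -> : \sum_(k < m) iota p`_k * y ^+ k = 0; last by rewrite mul0r => -[/eqP].
rewrite -[RHS](minPolyxx 1 y) pE (@horner_coef_wide _ m) ?size_map_poly ?szp //.
by apply: eq_bigr => i _; rewrite coef_map.
Qed.

(** The minimal polynomial of y is X^m - y^m, and zeta y is another root of it, so y -> zeta y
    extends to [L]. *)
Lemma exists_conjugation (zeta : K) : zeta ^+ m = 1 ->
  exists s : {rmorphism L -> L},
    (forall g, s (iota g) = iota g) /\ s y = cst zeta * y.
Proof.
move=> zeta1; have minE : minPoly 1 y = 'X^m - (y ^+ m)%:P.
  apply/eqP; rewrite -eqp_monic ?monic_minPoly ?monicXnsubC //.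
  by rewrite -dvdp_size_eqp ?minPoly_y_dvdp // size_minPoly_y size_XnsubC.
pose phi := kHomExtend 1 \1 y (cst zeta * y).
have hom1 : kHom 1 1 (\1%VF : 'End(L)) by apply: kHom1.
have root_zy : root (map_poly (\1%VF : 'End(L)) (minPoly 1 y)) (cst zeta * y).
  rewrite lfun1_poly minE /root !hornerE exprMn -[cst zeta ^+ m]rmorphXn zeta1.
  by rewrite [cst 1]rmorph1 mul1r subrr.
have phiM : monoid_morphism phi.
  apply/kHom_monoid_morphism; rewrite -L_gen.
  exact: (kHomExtendP (subvv _) hom1 root_zy).
pose phiMM := GRing.isMonoidMorphism.Build _ _ phi phiM.
pose s : {rmorphism L -> L} := HB.pack (fun_of_lfun phi) phiMM.
exists s; split=> [g|]; last exact: (kHomExtend_val hom1 root_zy).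
by rewrite /= linearZ /= phiM.1.
Qed.

(** Asking for all places above each affine point at once makes the notion stable under conjugation,
    which may permute the places above one point. *)
Definition finite_integral (z : L) : Prop :=
  forall (P : place cst) b, place_ideal P (lin L b) -> vring P z.

End Conjugation.

Lemma finite_integralM_cst a z : finite_integral z -> finite_integral (cst a * z).
Proof. by move=> Iz P b Pb; apply: vringM (vring_cst _ _) (Iz P b Pb). Qed.

Lemma finite_integral_sum (I : Type) (q : seq I) (w : I -> L) :
  (forall i, finite_integral (w i)) -> finite_integral (\sum_(i <- q) w i).
Proof. by move=> Iw P b Pb; apply: vring_sum => i _; apply: Iw Pb. Qed.

(** The preimage of a valuation ring under s is the ring of a place above the same b; regularity of
    z there is regularity of s z at P. *)
Lemma finite_integral_morph (s : {rmorphism L -> L}) z :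
  (forall g, s (iota g) = iota g) -> finite_integral z -> finite_integral (s z).
Proof.
move=> s_id Iz P b Pb.
have s_cst a : s (cst a) = cst a by apply: s_id.
have s_lin : s (lin L b) = lin L b by rewrite -iota_XsubC s_id.
have ringP : is_valuation_ring cst [set w | vring P (s w)].
  split; rewrite /mkset.
  - by move=> a; rewrite s_cst; apply: vring_cst.
  - by move=> u v Ou Ov; rewrite rmorphB; apply: vringB.
  - by move=> u v Ou Ov; rewrite rmorphM; apply: vringM.
  - exists (lin L b); first by rewrite s_lin; case: Pb.
    move=> a linE; have na : a != 0.
      apply/eqP=> a0; have := lin_neq0 L b.
      by rewrite linE a0 rmorph0 eqxx.
    by case: Pb => _ []; rewrite linE; apply: punit_cst.
  - exists (lin L b)^-1; rewrite fmorphV s_lin.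
    exact: pideal_inv (lin_neq0 L b) Pb.
  by move=> u; rewrite fmorphV; apply: vring_or_inv.
apply: (Iz (Place ringP) b); split=> /=; first by rewrite s_lin; case: Pb.
case=> _ _ /=; rewrite fmorphV s_lin.
exact: pideal_inv (lin_neq0 L b) Pb.
Qed.

(** * Separating the terms g_j(x) y^j and bounding their denominators *)

Hypotheses (m_neq0 : m%:R != 0 :> K) (alpha_inj : injective alpha).

(** Since m is nonzero in K, X^m - 1 is separable; its m distinct roots include a primitive one. *)
Lemma exists_primitive_root : exists zeta : K, m.-primitive_root zeta.
Proof.
have [s sE] := closed_field_poly_normal ('X^m - 1%:P : {poly K}).
rewrite (monicP (monicXnsubC 1 m_gt0)) scale1r in sE.
have us : uniq s.
  by rewrite -separable_prod_XsubC -sE cyclotomic.separable_Xn_sub_1 // polyC1.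
have : has m.-primitive_root s.
  apply: cyclic.has_prim_root => //.
    apply/allP=> z zs; rewrite unity_rootE.
    have : root (\prod_(z <- s) ('X - z%:P)) z by rewrite root_prod_XsubC.
    by rewrite -sE /root !hornerE subr_eq0.
  rewrite -ltnS -(size_prod_XsubC s id) -sE.
  by rewrite size_XnsubC.
by case/hasP=> z _; exists z.
Qed.

(* The j-th term is the projection of z onto an eigenspace of y -> zeta y. *)
Lemma finite_integral_term (P : place cst) (g : 'I_m -> ratfun K) (j : 'I_m) :
  place_ideal P x^-1 -> finite_integral (basis_sum g) ->
  finite_integral (iota (g j) * y ^+ j).
Proof.
move=> Px Iz; have [zeta zeta_prim] := exists_primitive_root.
have conj (i : nat) : exists w, finite_integral w /\
    w = \sum_(k < m) cst (zeta ^+ (i * k)) * (iota (g k) * y ^+ k).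
  have [|s [s_id sy]] := exists_conjugation Px (zeta := zeta ^+ i).
    by rewrite exprAC (prim_expr_order zeta_prim) expr1n.
  exists (s (basis_sum g)); split; first exact: finite_integral_morph.
  rewrite rmorph_sum; apply: eq_bigr => k _.
  rewrite rmorphM s_id rmorphXn sy exprMn mulrCA; congr (_ * _).
  by rewrite exprM -rmorphXn.
have /choice[w wP] := conj.
(* Discrete Fourier inversion, with m - j standing for -j: the k-th term is weighted by the sum of
   the powers of zeta^(k - j), which is m for k = j and 0 otherwise. *)
have sumE : \sum_(i < m) cst (zeta ^+ (i * (m - j))) * w i
    = cst m%:R * (iota (g j) * y ^+ j).
  transitivity (\sum_(k < m) \sum_(i < m)
      cst ((zeta ^+ (m - j + k)) ^+ i) * (iota (g k) * y ^+ k)).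
    rewrite exchange_big; apply: eq_bigr => i _.
    rewrite (wP i).2 mulr_sumr; apply: eq_bigr => k _.
    by rewrite mulrA -rmorphM -exprD -mulnDr mulnC exprM.
  have root_sum k : zeta ^+ (m - j + k) != 1 ->
      \sum_(i < m) (zeta ^+ (m - j + k)) ^+ i = 0.
    move=> nz1; apply: (mulfI (x := zeta ^+ (m - j + k) - 1)).
      by rewrite subr_eq0.
    by rewrite -subrX1 mulr0 exprAC (prim_expr_order zeta_prim) expr1n subrr.
  have sum_single (F : 'I_m -> L) : (forall k, k != j -> F k = 0) -> \sum_k F k = F j.
    by move=> F0; rewrite (bigD1 j) //= big1 ?addr0.
  rewrite sum_single => [|k nkj].
    rewrite -mulr_suml subnK; last exact: ltnW.
    rewrite (prim_expr_order zeta_prim); congr (_ * _).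
    rewrite (eq_bigr (fun=> 1)) => [|i _]; last by rewrite expr1n rmorph1.
    by rewrite sumr_const card_ord rmorph_nat.
  rewrite -mulr_suml -rmorph_sum root_sum ?rmorph0 ?mul0r //.
  rewrite -(prim_order_dvd zeta_prim); apply: contra nkj => dvd_m.
  (* As 0 < m + k - j < 2m, the only possible multiple of m is m itself, whence k = j. *)
  have := dvd_m; rewrite (_ : (m - j + k) = m + k - j)%N; last first.
    by have := ltn_ord j; lia.
  move=> /dvdnP[c cE]; apply/eqP/val_inj => /=.
  have := ltn_ord j; have := ltn_ord k.
  by case: c cE => [|[|c]]; rewrite ?mulSn; lia.
have -> : iota (g j) * y ^+ j = cst m%:R^-1 * (cst m%:R * (iota (g j) * y ^+ j)).
  by rewrite mulrA -rmorphM mulVf // rmorph1 mul1r.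
rewrite -sumE; apply: finite_integralM_cst; apply: finite_integral_sum => i.
by apply: finite_integralM_cst; case: (wP i).
Qed.

(** Locally at each b, the multiplicity of b in the denominator of g is at most its multiplicity in
    the numerator plus the floor exponent. Summing over all b bounds the degree. *)
Lemma finite_integral_deg g j : g != 0 -> finite_integral (iota g * y ^+ j) ->
  0 <= deg L g + (\sum_i (j * lambda i %/ m))%:Z.
Proof.
move=> ng Ig; pose E := root_seq alpha (fun i => j * lambda i %/ m)%N.
rewrite /deg -(size_root_seq alpha) -/E.
suffices : (size (factors L g).2 <= size ((factors L g).1 ++ E))%N.
  rewrite size_cat; move: (size E) (size _) (size _) => n1 n2 n3; lia.
(* The sum over b is replaced by an inclusion of multisets, which compares the sizes. *)
suffices /count_subseqP[s sub /perm_size->] : forall b,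
  (count_mem b (factors L g).2 <= count_mem b ((factors L g).1 ++ E))%N.
  exact: size_subseq.
move=> b; have [P Pb] := exists_finite_place L b.
have Oz := vringX m (Ig P b Pb); have Ug := finite_ord Pb ng.
have Uf := finite_prod_lin Pb (root_seq alpha lambda).
rewrite -curve_lin count_root_seq in Uf; set l := (\sum_(i | _) _)%N in Uf.
(* The m-th power of g y^j has an order computable inside K(x), as y^m vanishes to order l at b. *)
have : 0 <= ord L b g * m%:Z + (l * j)%:Z.
  apply: (vring_exprz (lin_neq0 L b) Pb).
  apply: (@vring_punitM _ _ _ P _
    ((iota g / lin L b ^ ord L b g) ^+ m * (y ^+ m / lin L b ^+ l) ^+ j)).
    by apply: punitM; apply: punitX.
  move: Oz; congr vring; rewrite expfzDr ?lin_neq0 // -exprz_exp -!exprnP exprM.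
  have fieldE (A B C D : L) : A != 0 -> B != 0 -> C * D = A * B * (C / A * (D / B)).
    by move=> *; field; do ?[apply/andP; split].
  rewrite !exprMn !exprVn [y ^+ j ^+ m]exprAC.
  by apply: fieldE; rewrite !expf_neq0 ?expfz_neq0 ?lin_neq0.
rewrite /ord count_cat count_root_seq.
have [[i0 bE]|nb] := pselect (exists i, alpha i = b).
  have eqb i : (alpha i == b) = (i == i0) by rewrite -bE (inj_eq alpha_inj).
  rewrite /l (eq_bigl _ _ eqb) big_pred1_eq (eq_bigl _ _ eqb) big_pred1_eq.
  move: (count_mem _ _) (count_mem _ _) (lambda i0) => c1 c2 l0 ge0.
  (* The order of g is an integer, so m ord >= -j l0 sharpens to ord >= -floor(j l0 / m). *)
  have := divn_eq (j * l0) m; have := ltn_pmod (j * l0) m_gt0; nia.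
have eqb i : (alpha i == b) = false by apply/eqP=> bE; apply: nb; exists i.
rewrite /l (eq_bigl _ _ eqb) big_pred0_eq; nia.
Qed.


Lemma weierstrass_sub_floor (Q : place cst) : place_ideal Q x^-1 ->
  weierstrass_semigroup Q `<=` floor_semigroup m lambda.
Proof.
move=> Qx s [z nz poleE].
have Iz : finite_integral z.
  move=> P b Pb; apply: (finite_vring_valuation Pb nz).
  have := congr1 (fun D => D P) poleE.
  rewrite /pole_divisor /multiple_of_place; case: asboolP => [PQ|_]; last by lia.
  (* P = Q is impossible: x is regular at P and has a pole at Q. *)
  have := pideal_inv (invr_neq0 (x_neq0 L)) Qx; rewrite invrK -PQ.
  by case; apply: finite_vring_x Pb.
have [t nt tP] := exists_infinite_parameter.
have [g zE] := basis_decomposition z.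
have ng : exists j, g j != 0 by apply: basis_sum_neq0; rewrite /basis_sum -zE.
have [j [nj Uj _]] := infinite_dominant nt tP Qx ng.
rewrite -zE in Uj; have vQ := infinite_valuation nt tP Qx Uj.
have Ij : finite_integral (iota (g j) * y ^+ j).
  by apply: (finite_integral_term j Qx); rewrite /basis_sum -zE.
have deg_ge0 := finite_integral_deg nj Ij.
have := congr1 (fun D => D Q) poleE.
rewrite /pole_divisor /multiple_of_place asboolT // vQ opprK /term_degree.
set n := (\sum_i _)%N in deg_ge0 *; set d := deg L _ in deg_ge0 *.
have [e_ge0|e_lt0] := leP 0 (m%:Z * d + lambda0%:Z * j%:Z) => sE.
  have [a aE] : exists a : nat, d + n%:Z = a%:Z by exists (absz (d + n%:Z)); lia.
  exists j, a; rewrite -/n; nia.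
(* A negative term degree means no pole at Q, so s = 0. *)
by exists 0%N, 0%N; rewrite big1 => [|i _]; rewrite ?mul0n ?div0n //; lia.
Qed.

End Kummer.

(** * The numerical semigroup *)

Section NumericalSemigroup.
Local Open Scope nat_scope.

Lemma generated_semigroup_mem (s : seq nat) n : n \in s -> generated_semigroup s n.
Proof.
move=> /(nthP 0)[i lt_i <-]; exists (fun j => nat_of_bool (j == Ordinal lt_i)).
rewrite (bigD1 (Ordinal lt_i)) //= eqxx mul1n big1 ?addn0 // => j /negPf->.
by rewrite mul0n.
Qed.

Lemma generated_semigroupD (s : seq nat) n n' : generated_semigroup s n ->
  generated_semigroup s n' -> generated_semigroup s (n + n').
Proof.
move=> [t ->] [t' ->]; exists (fun i => t i + t' i).
by rewrite -big_split; apply: eq_bigr => i _; rewrite mulnDl.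
Qed.

Lemma generated_semigroup_sub (A : set nat) (s : seq nat) : A 0 ->
  (forall n n', A n -> A n' -> A (n + n')) -> (forall n, n \in s -> A n) ->
  generated_semigroup s `<=` A.
Proof.
move=> A0 AD As _ [t ->]; elim/big_ind: _ => // i _.
have An := As _ (mem_nth 0 (ltn_ord i)).
by elim: (t i) => // c IHc; rewrite mulSn; apply: AD.
Qed.

Lemma generated_semigroup2 m n N :
  generated_semigroup [:: m; n] N <-> exists a b, N = m * a + n * b.
Proof.
split=> [[t ->]|[a [b ->]]].
  by rewrite !big_ord_recl big_ord0 /= addn0 mulnC [_ * n]mulnC; do 2!eexists.
apply: (generated_semigroupD (n := m * a)).
  elim: a => [|a IHa]; last first.
    rewrite mulnS; apply: generated_semigroupD => //.
    by apply: generated_semigroup_mem; rewrite mem_head.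
  by exists (fun=> 0); rewrite muln0 big1 // => i _; rewrite mul0n.
elim: b => [|b IHb].
  by exists (fun=> 0); rewrite muln0 big1 // => i _; rewrite mul0n.
rewrite mulnS; apply: generated_semigroupD => //; apply: generated_semigroup_mem.
by rewrite !inE eqxx orbT.
Qed.

(** Raise one coordinate by one at a time, inside its bound, until the sum reaches k. *)
Lemma interpolate_sum (I : finType) (l u : I -> nat) k : (forall i, l i <= u i) ->
  \sum_i l i <= k <= \sum_i u i ->
  exists s : I -> nat, (forall i, l i <= s i <= u i) /\ \sum_i s i = k.
Proof.
have [d] := ubnP (k - \sum_i l i); elim: d l => // d IHd l lt_d le_lu /andP[le_lk le_ku].
have [eq_k|lt_k] : \sum_i l i = k \/ \sum_i l i < k.
- by lia.
- by exists l; split=> // i; rewrite leqnn le_lu.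
have [i lt_i] : exists i, l i < u i.
  apply: contrapT => nex; have : \sum_i u i <= \sum_i l i.
    apply: leq_sum => i _; rewrite leqNgt; apply/negP => lt_i.
    by apply: nex; exists i.
  by lia.
pose l' j := l j + (j == i).
have suml' : \sum_j l' j = (\sum_j l j).+1.
  rewrite big_split /= (bigD1 i (F := fun j => nat_of_bool (j == i))) //= eqxx.
  by rewrite [X in _ + (_ + X)]big1 ?addn1 // => j /negPf->.
have [|||s [sP sumk]] := IHd l'.
- by rewrite suml'; lia.
- by move=> j; rewrite /l'; case: eqP => [->|_]; rewrite ?addn1 ?addn0 ?lt_i ?le_lu.
- by rewrite suml' lt_k.
exists s; split=> // j; have /andP[le1 ->] := sP j; rewrite andbT.
by apply: leq_trans le1; apply: leq_addr.
Qed.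

(** * Floor sums, the sets [B_set] and generators *)

Variables (m r : nat) (lambda : 'I_r -> nat).
Local Notation lambda0 := (lambda_sum lambda).
Local Notation floor_sum j := (\sum_i (j * lambda i %/ m)).
Hypothesis m_gt0 : 0 < m.
Hypothesis lambda_bounds : forall i, 1 <= lambda i < m.

Lemma floor_semigroup0 : floor_semigroup m lambda 0.
Proof. by exists 0, 0; rewrite big1 => [|i _]; rewrite ?mul0n ?div0n ?muln0. Qed.

(** The floor sum is superadditive in j; the excess is absorbed by enlarging the coefficient of
    m. *)
Lemma floor_semigroupD n n' : floor_semigroup m lambda n ->
  floor_semigroup m lambda n' -> floor_semigroup m lambda (n + n').
Proof.
move=> [j [a nE]] [j' [a' nE']]; exists (j + j').
have : floor_sum j + floor_sum j' <= floor_sum (j + j').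
  rewrite -big_split; apply: leq_sum => i _; rewrite mulnDl /=.
  by rewrite leq_divRL // mulnDl leq_add // leq_divM.
move: (floor_sum _) (floor_sum j) (floor_sum j') nE nE' => f f1 f2 nE nE' le_f.
by exists (a + a' + (f - (f1 + f2))); nia.
Qed.

(** Unfolds the maximum of minima. Positivity of k' matters because the empty maximum is 0. *)
Lemma eta_valP k k' : 0 < k' <= eta_val m lambda k ->
  exists s : {ffun 'I_r -> 'I_k.+1}, admissible lambda s /\
    forall i, k' * lambda i <= s i * m.
Proof.
move=> /andP[k'_gt0 le_eta]; apply: contrapT => nex.
suffices : eta_val m lambda k <= k'.-1 by lia.
apply/bigmax_leqP => s adm_s; rewrite -ltnS prednK // ltnNge; apply/negP => le_k'.
apply: nex; exists s; split=> // i; have /andP[l_gt0 _] := lambda_bounds i.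
by rewrite -leq_divRL //; apply: leq_trans le_k' (bigmin_leq _ _ _ _).
Qed.

(** The bound k' <= m accounts for the unit m of the minimum in [eta_val]. *)
Lemma eta_val_geq k k' (s : 'I_r -> nat) : k' <= m -> \sum_i s i = k ->
  (forall i, 1 <= s i <= lambda i) -> (forall i, k' * lambda i <= s i * m) ->
  k' <= eta_val m lambda k.
Proof.
move=> le_k'm sum_s s_bounds le_s.
pose s' : {ffun 'I_r -> 'I_k.+1} := [ffun i => inord (s i)].
have s'E i : s' i = s i :> nat.
  by rewrite ffunE inordK // ltnS -sum_s (bigD1 i) //= leq_addr.
have adm : admissible lambda s'.
  apply/andP; split; last by apply/forallP=> i; rewrite s'E.
  by rewrite (eq_bigr s) ?sum_s // => i _; rewrite s'E.
apply: leq_trans (leq_bigmax_cond _ adm).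
elim/big_ind: _ => // [a b le_a le_b|i _]; first by rewrite leq_min le_a.
by rewrite leq_divRL ?s'E //; case/andP: (lambda_bounds i).
Qed.

Lemma B_set_sub_floor k : k < lambda0 ->
  B_set m lambda k `<=` floor_semigroup m lambda.
Proof.
move=> lt_k _ [k' /= k'_bounds <-].
have [s [/andP[/eqP sum_s _] le_s]] := eta_valP k'_bounds.
case/andP: k'_bounds => k'_gt0 le_eta.
have le_mk : k' * lambda0 <= m * k.
  apply: leq_trans (eta_lambda_leq m lambda k); rewrite mulnC.
  by rewrite leq_mul2l le_eta orbT.
have lt_k'm : k' < m by nia.
(* With j = m - k', lambda_i minus its floor term is ceil(k' lambda_i / m), which is at most s_i.
   Summing over i shows that the coefficient k + f - lambda0 of m is nonnegative. *)
exists (m - k').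
have : lambda0 <= floor_sum (m - k') + k.
  rewrite -sum_s -big_split; apply: leq_sum => i _ /=.
  rewrite addnC -leq_subLR leq_divRL //; have := le_s i; nia.
move: (floor_sum _) => f le_f.
by exists (f + k - lambda0); nia.
Qed.

(** Raising j by m raises the floor sum by lambda0, so both sides of the equation grow by m lambda0
    and a is unchanged. *)
Lemma floor_semigroup_small N : floor_semigroup m lambda N ->
  exists j a, j < m /\ N + m * floor_sum j = m * a + lambda0 * j.
Proof.
move=> [j [a NE]]; exists (j %% m), a; split; first exact: ltn_pmod.
have sumE : floor_sum j = j %/ m * lambda0 + floor_sum (j %% m).
  rewrite /lambda_sum big_distrr -big_split; apply: eq_bigr => i _ /=.
  by rewrite {1}(divn_eq j m) mulnDl mulnAC divnMDl.
move: NE; rewrite sumE {3}(divn_eq j m); move: (floor_sum _) => f; nia.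
Qed.

Lemma floor_sub_union N : floor_semigroup m lambda N ->
  generated_semigroup [:: m; lambda0] N \/
  exists2 k, r <= k < lambda0 & B_set m lambda k N.
Proof.
move=> /floor_semigroup_small[j [a [lt_jm NE]]].
have [j0|j_gt0] := posnP j.
  left; apply/generated_semigroup2; exists a, 0; move: NE.
  by rewrite j0 big1 => [|i _]; rewrite ?mul0n ?div0n // muln0 addn0.
(* This is ceil((m - j) lambda_i / m), the least s_i compatible with k' = m - j; it is positive
   because j < m. *)
pose c i := lambda i - j * lambda i %/ m.
have lt_floor i : j * lambda i %/ m < lambda i.
  have /andP[l_gt0 _] := lambda_bounds i.
  by rewrite ltn_divLR // mulnC ltn_pmul2l.
have sumc : \sum_i c i + floor_sum j = lambda0.
  rewrite -big_split; apply: eq_bigr => i _; rewrite /= subnK //; exact: ltnW.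
pose k := a + \sum_i c i.
have le_rk : r <= k.
  rewrite -[r]card_ord -sum1_card; apply: leq_trans (leq_addl _ _).
  by apply: leq_sum => i _; rewrite subn_gt0.
(* The element equals m k - (m - j) lambda0, so for k >= lambda0 it is m (k - lambda0) + j
   lambda0. *)
have [lt_k|le_k] := ltnP k lambda0; last first.
  left; apply/generated_semigroup2; exists (k - lambda0), j.
  move: sumc NE; rewrite /k in le_k *; move: (floor_sum _) (\sum_i c i) le_k => f d; nia.
right; exists k; first by rewrite le_rk.
exists (m - j) => /=; last first.
  move: sumc NE; rewrite /k; move: (floor_sum _) (\sum_i c i) => f d; nia.
rewrite subn_gt0 lt_jm /=.
have [||s [s_bounds sum_s]] := @interpolate_sum 'I_r c lambda k.
- by move=> i; apply: leq_subr.
- by rewrite leq_addl ltnW.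
apply: (eta_val_geq (s := s)) sum_s _ _ => //; first exact: leq_subr.
  move=> i; have /andP[le_cs ->] := s_bounds i; rewrite andbT.
  by apply: leq_trans le_cs; rewrite subn_gt0.
move=> i; have /andP[le_cs _] := s_bounds i.
apply: (@leq_trans (c i * m)); last by rewrite leq_mul2r le_cs orbT.
by rewrite /c !mulnBl [m * _]mulnC leq_sub2l // leq_divM.
Qed.

Lemma floor_semigroup_m : floor_semigroup m lambda m.
Proof. by exists 0, 1; rewrite big1 => [|i _]; rewrite ?mul0n ?div0n //; lia. Qed.

Lemma floor_semigroup_lambda : floor_semigroup m lambda lambda0.
Proof. by exists 1, (floor_sum 1); rewrite muln1 addnC. Qed.

Lemma gen2_sub_floor : generated_semigroup [:: m; lambda0] `<=` floor_semigroup m lambda.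
Proof.
apply: generated_semigroup_sub floor_semigroup0 floor_semigroupD _ => n.
rewrite !inE => /orP[]/eqP->; [exact: floor_semigroup_m|exact: floor_semigroup_lambda].
Qed.

Lemma floor_semigroupE : floor_semigroup m lambda =
  generated_semigroup [:: m; lambda0] `|`
  \bigcup_(k in [set k | r <= k < lambda0]) B_set m lambda k.
Proof.
apply/seteqP; split=> N.
  by case/floor_sub_union=> [|[k k_bounds Bk]]; [left|right; exists k].
case=> [/gen2_sub_floor //|[k /= /andP[_ lt_k]]].
exact: B_set_sub_floor.
Qed.

(** Within one [B_set] the element with k' = eta_k is the least, and the others differ from it by
    multiples of lambda0. *)
Lemma floor_semigroup_generated : floor_semigroup m lambda =
  generated_semigroup [:: m, lambda0
    & [seq m * k - lambda0 * eta_val m lambda k | k <- index_iota r lambda0]].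
Proof.
set gens := [:: _, _ & _].
have gen_m : generated_semigroup gens m.
  by apply: generated_semigroup_mem; rewrite mem_head.
have gen_l : generated_semigroup gens lambda0.
  by apply: generated_semigroup_mem; rewrite !inE eqxx orbT.
have gen0 : generated_semigroup gens 0.
  by exists (fun=> 0); rewrite big1 // => i _; rewrite mul0n.
apply/seteqP; split=> N.
  case/floor_sub_union => [|[k k_bounds [k' /= /andP[k'_gt0 le_eta] <-]]].
    apply: generated_semigroup_sub gen0 (@generated_semigroupD gens) _ N => n.
    by rewrite !inE => /orP[]/eqP->.
  have le_mk := eta_lambda_leq m lambda k.
  have -> : m * k - k' * lambda0 =
      m * k - lambda0 * eta_val m lambda k + (eta_val m lambda k - k') * lambda0.
    move: (eta_val _ _ _) le_mk le_eta => h; nia.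
  apply: generated_semigroupD.
    apply: generated_semigroup_mem; rewrite !inE; apply/orP; right; apply/orP; right.
    by apply/mapP; exists k; rewrite // mem_index_iota.
  elim: (_ - _) => // n IHn; rewrite mulSn; exact: generated_semigroupD.
apply: generated_semigroup_sub floor_semigroup0 floor_semigroupD _ N => n.
rewrite !inE => /orP[/eqP->|/orP[/eqP->|/mapP[k]]].
- exact: floor_semigroup_m.
- exact: floor_semigroup_lambda.
rewrite mem_index_iota => /andP[_ lt_k] ->.
(* When eta_k = 0 the set [B_set] is empty and the listed generator is just m k. *)
have [->|eta_gt0] := posnP (eta_val m lambda k).
  by rewrite muln0 subn0; apply/gen2_sub_floor/generated_semigroup2; exists k, 0; lia.
apply: (B_set_sub_floor lt_k); exists (eta_val m lambda k) => /=.
  by rewrite eta_gt0 leqnn.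
by rewrite mulnC [_ * lambda0]mulnC [k * m]mulnC.
Qed.

Lemma B_set_leq k k' : k' <= eta_val m lambda k -> k' * lambda0 <= m * k.
Proof.
move=> le_eta; apply: leq_trans (eta_lambda_leq m lambda k).
by rewrite mulnC leq_mul2l le_eta orbT.
Qed.

(** * Disjointness by divisibility by lambda0 *)

Hypothesis coprime_m : coprime m lambda0.

(** Coprimality makes lambda0 divide b - a, which lies strictly between 0 and lambda0. A common
    element of two of the sets always yields such an equation. *)
Lemma lambda_multiple_absurd a b c : a < b < lambda0 -> b - a < lambda0 ->
  m * b = m * a + c * lambda0 -> False.
Proof.
move=> /andP[lt_ab lt_b] lt_sub eq_c.
have : lambda0 %| m * (b - a).
  by apply/dvdnP; exists c; rewrite mulnBr eq_c addKn.
rewrite Gauss_dvdr 1?coprime_sym // => /dvdn_leq; rewrite subn_gt0 lt_ab => /(_ isT).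
by lia.
Qed.

Lemma gen2_B_disjoint k : k < lambda0 ->
  generated_semigroup [:: m; lambda0] `&` B_set m lambda k = set0.
Proof.
move=> lt_k; apply/seteqP; split=> // N [/generated_semigroup2[a [b NE]]].
case=> k' /= /andP[k'_gt0 /B_set_leq le_mk] NE'.
apply: (@lambda_multiple_absurd a k (b + k')); nia.
Qed.

Lemma B_disjoint k l : k < lambda0 -> l < lambda0 -> k <> l ->
  B_set m lambda k `&` B_set m lambda l = set0.
Proof.
wlog lt_kl : k l / k < l.
  move=> IH lt_k lt_l nkl; have [lt|lt|//] := ltngtP k l; first exact: IH.
  by rewrite setIC; apply: IH => //; apply: nesym.
move=> lt_k lt_l _; apply/seteqP; split=> // N [].
case=> k' /= /andP[_ /B_set_leq le_mk] NE.
case=> l' /= /andP[_ /B_set_leq le_ml] NE'.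
apply: (@lambda_multiple_absurd k l (l' - k')); nia.
Qed.

End NumericalSemigroup.

Theorem theorem3p2
  (p e q : nat) (p_prime : prime p) (e_gt0 : (0 < e)%N) (q_def : q = (p ^ e)%N)
  (Fq : finFieldType) (card_Fq : #|Fq| = q)
  (K : closedFieldType) (j : {rmorphism Fq -> K})
  (K_closure : is_algebraic_closure j)
  (m r : nat) (m_ge2 : (2 <= m)%N) (r_ge2 : (2 <= r)%N)
  (p_ndvd_m : ~~ (p %| m)%N)
  (alpha : 'I_r -> K) (alpha_inj : injective alpha)
  (lambda : 'I_r -> nat)
  (lambda_bounds : forall i, (1 <= lambda i < m)%N)
  (gcd_m_lambda : gcdn m (lambda_sum lambda) = 1%N)
  (L : fieldExtType (ratfun K)) (y : L)
  (L_gen : <<1; y>>%VS = fullv)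
  (curve_eq :
     y ^+ m = \prod_(i < r) (ext_x L - ext_const L (alpha i)) ^+ lambda i)
  (Pinf : place (ratfun_const K))
  (Pinf_pole : valuation Pinf (ratfun_x K) < 0)
  (Qinf : place (ext_const L))
  (Qinf_over : lies_over (in_alg L) Qinf Pinf) :
  let lambda0 := lambda_sum lambda in
  let indices := [set k | (r <= k < lambda0)%N] in
  [/\ weierstrass_semigroup Qinf =
        generated_semigroup [:: m; lambda0] `|`
        \bigcup_(k in indices) B_set m lambda k,
      forall k, indices k ->
        generated_semigroup [:: m; lambda0] `&` B_set m lambda k = set0,
      forall k l, indices k -> indices l -> k <> l ->
        B_set m lambda k `&` B_set m lambda l = set0
    & weierstrass_semigroup Qinf =
        generated_semigroup
          [:: m, lambda0
            & [seq (m * k - lambda0 * eta_val m lambda k)%N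
              | k <- index_iota r lambda0]]].
Proof.
have m_gt0 : (0 < m)%N by apply: leq_trans m_ge2.
have coprime_m : coprime m (lambda_sum lambda) by apply/eqP.
(* The characteristic of the finite field passes to K along [j], and p not dividing m makes m
   invertible in K. *)
have char_K : p \in [pchar K].
  by apply: (rmorph_pchar j); apply: (card_finPcharP (n := e)); rewrite ?card_Fq.
have m_neq0 : m%:R != 0 :> K by rewrite -(dvdn_pcharf char_K).
(* The pole of x puts x^-1 in the ideal of [Pinf], and lying over carries it to [Qinf]. *)
have Qx : place_ideal Qinf (ext_x L)^-1.
  have := Qinf_over _ (valuation_lt0 Pinf_pole).
  by rewrite fmorphV.
have -> : weierstrass_semigroup Qinf = floor_semigroup m lambda.
  apply/seteqP; split.
    exact: (weierstrass_sub_floor m_gt0 coprime_m L_gen curve_eq m_neq0 alpha_inj).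
  exact: (floor_sub_weierstrass m_gt0 coprime_m L_gen curve_eq).
move=> lambda0 indices; split.
- exact: floor_semigroupE.
- by move=> k /andP[_ lt_k]; apply: gen2_B_disjoint.
- by move=> k l /andP[_ lt_k] /andP[_ lt_l]; apply: B_disjoint.
exact: floor_semigroup_generated.
Qed.
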